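(* Let $(M,g,\nabla)$ be a statistical manifold of dimension $n\ge 4$. If $(M,g,\nabla)$ is of constant curvature, then $(M,g,\nabla)$ is conformally-projectively flat.
   Context: A statistical manifold $(M,g,\nabla)$ is a smooth manifold $M$ with a Riemannian metric $g$ and a torsion-free affine connection $\nabla$ such that $\nabla g$ is a totally symmetric $(0,3)$-tensor field. The curvature tensor of $\nabla$ is $R(X,Y)Z=\nabla_X\nabla_YZ-\nabla_Y\nabla_XZ-\nabla_{[X,Y]}Z$. $(M,g,\nabla)$ is of constant curvature if there is a constant $K\in\mathbb{R}$ such that $R(X,Y)Z=K\{g(Y,Z)X-g(X,Z)Y\}$ for all smooth vector fields $X,Y,Z$ on $M$. Two statistical manifolds $(M,g,\nabla)$ and $(M,\bar g,\bar\nabla)$ are conformally-projectively equivalent if there exist functions $\varphi,\psi\in C^{\infty}(M)$ such that $$\bar g(X,Y)=e^{\varphi+\psi}g(X,Y),\qquad \bar\nabla_XY=\nabla_XY+d\varphi(X)Y+d\varphi(Y)X-g(X,Y)\,\mathrm{grad}_g\psi$$ for all smooth vector fields $X,Y$ on $M$. A statistical manifold is flat if the curvature tensor of its connection vanishes. $(M,g,\nabla)$ is conformally-projectively flat if every point of $M$ has an open neighbourhood $U$ such that $(U,g|_U,\nabla|_U)$ is conformally-projectively equivalent to a flat statistical manifold $(U,\bar g,\bar\nabla)$. *)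

(* Defs.v *)
From HB Require Import structures.
From mathcomp Require Import all_boot all_order all_algebra.
From mathcomp Require Import all_classical all_reals all_analysis.

Set Implicit Arguments.
Unset Strict Implicit.
Unset Printing Implicit Defensive.

Import Order.TTheory GRing.Theory Num.Theory.
Import numFieldNormedType.Exports.

Local Open Scope classical_set_scope.
Local Open Scope ring_scope.

(* The library has no smooth manifolds.  A smooth manifold is here a           *)
(* topological space M with an atlas A.  Objects living on an open subset U of *)
(* M (functions, vector fields, metrics, connections) are total on M, with     *)
(* irrelevant values off U, and every notion is relative to an open set U: the *)
(* open submanifold U and the restriction of an object from M to U need no     *)
(* separate construction, and the manifold M itself is the case U = setT.      *)

Section SmoothManifold.
Context {R : realType}.

Fixpoint Ck (k : nat) (V W : normedModType R) (D : set V) (f : V -> W) : Prop :=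
  match k with
  | 0%N => forall x, D x -> {for x, continuous f}
  | k'.+1 => (forall x, D x -> differentiable f x) /\
             (forall v, Ck k' D ('D_v f))
  end.

Definition Cinfty (V W : normedModType R) (D : set V) (f : V -> W) : Prop :=
  forall k, Ck k D f.

Record chart (M : topologicalType) (n : nat) := Chart {
  chart_dom : set M ;
  chart_map :> M -> 'rV[R]_n ;
  chart_inv : 'rV[R]_n -> M ;
  chart_dom_open : open chart_dom ;
  chart_img_open : open (chart_map @` chart_dom) ;
  chart_mapK : forall p, chart_dom p -> chart_inv (chart_map p) = p ;
  chart_map_cont : forall p, chart_dom p -> {for p, continuous chart_map} ;
  chart_inv_cont : forall x, (chart_map @` chart_dom) x ->
    {for x, continuous chart_inv} }.

Record smooth_manifold (M : topologicalType) (n : nat) (A : set (chart M n)) :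
    Prop := SmoothManifold {
  manifold_hausdorff : hausdorff_space M ;
  manifold_second_countable : @second_countable M ;
  manifold_cover : forall p : M, exists2 c, A c & chart_dom c p ;
  manifold_compat : forall c d, A c -> A d ->
    Cinfty (c @` (chart_dom c `&` chart_dom d)) (d \o chart_inv c) }.

Section Calculus.
Context {M : topologicalType} {n : nat}.
Variable A : set (chart M n).
Implicit Types (U W : set M) (p : M) (f phi psi : M -> R).

Definition smooth_on U f : Prop :=
  forall c, A c -> Cinfty (c @` (chart_dom c `&` U)) (f \o chart_inv c).

Definition smooth_at p f : Prop :=
  exists W, [/\ open W, W p & smooth_on W f].

(* Tangent vectors at p are operators on functions, namely the directional     *)
(* derivatives at p along a vector w of R^n in a chart around p.  They are set *)
(* to 0 on the functions that are not smooth around p, so that two tangent     *)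
(* vectors with the same values on smooth functions are equal.                 *)
Definition tvec : Type := (M -> R) -> R.

Definition tangent p (v : tvec) : Prop :=
  (exists c, [/\ A c, chart_dom c p &
     exists w : 'rV[R]_n, forall f, smooth_at p f ->
       v f = 'D_w (f \o chart_inv c) (c p)]) /\
  (forall f, ~ smooth_at p f -> v f = 0).

Definition vfield : Type := M -> tvec.
Implicit Types (X Y Z : vfield).

Definition smooth_vfield U X : Prop :=
  (forall p, U p -> tangent p (X p)) /\
  (forall W f, open W -> W `<=` U -> smooth_on W f ->
     smooth_on W (fun p => X p f)).

Definition vadd X Y : vfield := fun p => X p + Y p.
Definition vscale f X : vfield := fun p => f p *: X p.

(* The guard is needed because p |-> Y p f may be smooth although f is not.    *)
Definition bracket X Y : vfield := fun p f =>
  if `[< smooth_at p f >]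
  then X p (fun q => Y q f) - Y p (fun q => X q f) else 0.

Definition metric : Type := M -> tvec -> tvec -> R.

Record riemannian_metric U (g : metric) : Prop := RiemannianMetric {
  metric_linear : forall p, U p -> forall (a : R) (u v w : tvec),
    tangent p u -> tangent p v -> tangent p w ->
    g p (a *: u + v) w = a * g p u w + g p v w ;
  metric_sym : forall p, U p -> forall u v : tvec,
    tangent p u -> tangent p v -> g p u v = g p v u ;
  metric_pos : forall p, U p -> forall u : tvec,
    tangent p u -> u <> 0 -> 0 < g p u u ;
  metric_smooth : forall W X Y, open W -> W `<=` U ->
    smooth_vfield W X -> smooth_vfield W Y ->
    smooth_on W (fun p => g p (X p) (Y p)) }.

(* The axioms are required on every open W included in U, so that one operator *)
(* also acts on vector fields that are smooth on W only; this is the extension *)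
(* by locality of the usual operator on the smooth vector fields on U.         *)
(* Locality follows from the axioms: if X and X' agree on W and f is the       *)
(* indicator function of W (smooth on W), then f X = f X', and tensoriality    *)
(* (or, in the second argument, the Leibniz rule) gives the same value on W.   *)
Definition connection : Type := vfield -> vfield -> vfield.

Record affine_connection U (nabla : connection) : Prop := AffineConnection {
  connection_smooth : forall W X Y, open W -> W `<=` U ->
    smooth_vfield W X -> smooth_vfield W Y -> smooth_vfield W (nabla X Y) ;
  connection_addl : forall W X X' Y, open W -> W `<=` U ->
    smooth_vfield W X -> smooth_vfield W X' -> smooth_vfield W Y ->
    forall p, W p -> nabla (vadd X X') Y p = nabla X Y p + nabla X' Y p ;
  connection_scalel : forall W f X Y, open W -> W `<=` U ->
    smooth_on W f -> smooth_vfield W X -> smooth_vfield W Y ->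
    forall p, W p -> nabla (vscale f X) Y p = f p *: nabla X Y p ;
  connection_addr : forall W X Y Y', open W -> W `<=` U ->
    smooth_vfield W X -> smooth_vfield W Y -> smooth_vfield W Y' ->
    forall p, W p -> nabla X (vadd Y Y') p = nabla X Y p + nabla X Y' p ;
  connection_leibniz : forall W f X Y, open W -> W `<=` U ->
    smooth_on W f -> smooth_vfield W X -> smooth_vfield W Y ->
    forall p, W p ->
    nabla X (vscale f Y) p = X p f *: Y p + f p *: nabla X Y p }.

Definition torsion_free U (nabla : connection) : Prop :=
  forall X Y, smooth_vfield U X -> smooth_vfield U Y ->
  forall p, U p -> nabla X Y p - nabla Y X p = bracket X Y p.

(* (nabla_X g)(Y, Z) *)
Definition cov_metric (g : metric) (nabla : connection) X Y Z : M -> R :=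
  fun p => X p (fun q => g q (Y q) (Z q))
           - g p (nabla X Y p) (Z p) - g p (Y p) (nabla X Z p).

Definition totally_symmetric U (C : vfield -> vfield -> vfield -> M -> R) :
    Prop :=
  forall X Y Z, smooth_vfield U X -> smooth_vfield U Y -> smooth_vfield U Z ->
  forall p, U p -> C X Y Z p = C Y X Z p /\ C X Y Z p = C X Z Y p.

Record statistical_manifold U (g : metric) (nabla : connection) : Prop :=
  StatisticalManifold {
  stat_metric : riemannian_metric U g ;
  stat_connection : affine_connection U nabla ;
  stat_torsion_free : torsion_free U nabla ;
  stat_symmetric : totally_symmetric U (cov_metric g nabla) }.

Definition curvature (nabla : connection) X Y Z : vfield := fun p =>
  nabla X (nabla Y Z) p - nabla Y (nabla X Z) p - nabla (bracket X Y) Z p.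

Definition constant_curvature U (g : metric) (nabla : connection) : Prop :=
  exists K : R, forall X Y Z,
  smooth_vfield U X -> smooth_vfield U Y -> smooth_vfield U Z ->
  forall p, U p ->
  curvature nabla X Y Z p =
    K *: (g p (Y p) (Z p) *: X p - g p (X p) (Z p) *: Y p).

Definition flat U (nabla : connection) : Prop :=
  forall X Y Z,
  smooth_vfield U X -> smooth_vfield U Y -> smooth_vfield U Z ->
  forall p, U p -> curvature nabla X Y Z p = 0.

(* The differential of f at p is v |-> v f.                                    *)
Definition grad (g : metric) f : vfield := fun p =>
  xget 0 [set w : tvec | tangent p w /\
    forall v, tangent p v -> g p w v = v f].

Definition conformally_projectively_equivalent U
    (g : metric) (nabla : connection) (g' : metric) (nabla' : connection) :
    Prop :=
  exists phi psi, [/\ smooth_on U phi, smooth_on U psi &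
    forall X Y, smooth_vfield U X -> smooth_vfield U Y -> forall p, U p ->
      g' p (X p) (Y p) = expR (phi p + psi p) * g p (X p) (Y p) /\
      nabla' X Y p = nabla X Y p + X p phi *: Y p + Y p phi *: X p
                     - g p (X p) (Y p) *: grad g psi p].

Definition conformally_projectively_flat (g : metric) (nabla : connection) :
    Prop :=
  forall p, exists U (g' : metric) (nabla' : connection),
    [/\ open U, U p, statistical_manifold U g' nabla', flat U nabla' &
        conformally_projectively_equivalent U g nabla g' nabla'].

End Calculus.
End SmoothManifold.

Arguments chart R M n : clear implicits.
Arguments tvec R M : clear implicits.
Arguments vfield R M : clear implicits.
Arguments metric R M : clear implicits.
Arguments connection R M : clear implicits.

(* Main.v *)
Require Import Defs.
From HB Require Import structures.
From mathcomp Require Import all_boot all_order all_algebra.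
From mathcomp Require Import all_classical all_reals all_analysis.
From mathcomp Require Import ring lra.

Set Implicit Arguments.
Unset Strict Implicit.
Unset Printing Implicit Defensive.

Import Order.TTheory GRing.Theory Num.Theory.
Import numFieldNormedType.Exports.

Local Open Scope classical_set_scope.
Local Open Scope ring_scope.

(** If K is the curvature, the flat statistical structure is obtained with
    psi = 0, that is by a projective change of the connection,
    nabla'_X Y = nabla_X Y + dphi(X) Y + dphi(Y) X, and the metric exp(phi) g.
    For every phi, nabla' is torsion-free and the cubic form nabla' g' is
    totally symmetric (proj_statistical). Its curvature tensor is
      R'(X,Y)Z = R(X,Y)Z + H(X,Z) Y - H(Y,Z) X,  H = Hess phi - dphi dphi,
    so nabla' is flat as soon as H = K g (proj_flat).

    Writing phi = - ln u, this nonlinear equation becomes the linear one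
    Hess u = - K u g (log_hessian). In a chart it is a total system for u and
    its partial derivatives: all first derivatives of the unknowns are
    prescribed linear functions of the unknowns. Its integrability conditions
    are the expression of constant curvature, the symmetry of nabla g and the
    vanishing of the torsion in coordinates (hessian_system_integrable), so
    a solution with u = 1 at the given point exists near that point, and u stays
    positive on a smaller neighbourhood (hessian_solution).

    The existence theorem for integrable linear total systems is
    linear_frobenius. The system is first solved along the rays issued from the
    base point, as an ordinary differential equation on [0, 1] (linear_ode).
    Comparing two neighbouring rays by a Gronwall inequality shows that the
    function so defined is differentiable and satisfies the whole system
    (small_total_system_solution); no derivative with respect to a parameter is
    taken. Since the system expresses the derivatives of the solution through
    the solution itself, smoothness follows by induction (total_system_smooth).

    The hypotheses on nabla and g are about vector fields on the whole of M,
    whereas the equations in a chart concern the coordinate vector fields.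
    These are extended to M after multiplication by a plateau function
    (vfield_extension), and covariant derivatives are local (nabla_local), so
    that all the hypotheses hold on open subsets. The coordinate vector fields
    commute because their bracket, being a difference of covariant derivatives,
    is a tangent vector, and it kills the coordinates (bracket_partial). *)

(** * Functions of class C^k on open sets *)

Section DifferentialEstimates.
Context {R : realType} {V W : normedModType R}.
Implicit Types (f g : V -> W).

Lemma differentiable_of_estimate f (L : {linear V -> W}) x :
  continuous L ->
  (forall e, 0 < e -> \forall h \near (0 : V), `|f (h + x) - f x - L h| <= e * `|h|) ->
  differentiable f x /\ 'd f x = L :> (V -> W).
Proof.
move=> cL H.
have E : f \o shift x = cst (f x) + L +o_ 0 id.
  apply/eqaddoP => e e0; near=> h => /=.
  have -> : (f \o shift x - (cst (f x) + L)) h = f (h + x) - f x - L h.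
    by rewrite /= opprD addrA.
  by near: h; exact: H.
have dE := diff_unique cL E.
by split => //; apply/diff_locallyP; rewrite dE; split.
Unshelve. all: by end_near. Qed.

Lemma near_eq_differentiable f g x :
  (\forall y \near x, f y = g y) -> differentiable g x -> differentiable f x.
Proof.
move=> fg dg; have cL : continuous ('d g x) by exact: diff_continuous.
suff H : forall e, 0 < e ->
    \forall h \near (0 : V), `|f (h + x) - f x - 'd g x h| <= e * `|h|.
  by have [] := differentiable_of_estimate cL H.
move=> e e0.
have /diff_locallyP [_ /eqaddoP/(_ e e0) H] := dg.
have fgx : f x = g x by exact: nbhs_singleton fg.
have fg0 : \forall h \near (0 : V), f (h + x) = g (h + x).
  move: fg => /nbhs_ballP[d /= d0 Hd]; apply/nbhs_ballP; exists d => //= h.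
  rewrite -ball_normE /= sub0r normrN => hd; apply: Hd; rewrite -ball_normE /=.
  by rewrite opprD addrCA subrr addr0 normrN.
near=> h.
rewrite fgx (near fg0 h)//.
have -> : g (h + x) - g x - 'd g x h =
    (g \o shift x - (cst (g x) + 'd g x)) h by rewrite /= opprD addrA.
by near: h; exact: H.
Unshelve. all: by end_near. Qed.

End DifferentialEstimates.

Section Ck.
Context {R : realType}.
Implicit Types (V W : normedModType R) (k : nat).

Lemma near_open V (D : set V) x (P : V -> Prop) :
  open D -> D x -> (forall y, D y -> P y) -> \forall y \near x, P y.
Proof. by move=> oD Dx H; apply: filterS H _; exact: open_nbhs_nbhs. Qed.

(** Functions are total and only their values on an open set matter, so nearly
    every argument has to exchange a function for one with the same germs. *)
Lemma Ck_local V W k (D : set V) (f : V -> W) :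
  (forall x, D x -> exists E g,
     [/\ open E, E x, (forall y, E y -> f y = g y) & Ck k E g]) -> Ck k D f.
Proof.
elim: k D f => [|k IH] D f H.
  move=> x /H[E [g [oE Ex fg cg]]].
  have n := near_open oE Ex fg.
  have := cg _ Ex; rewrite /continuous_at /prop_for (fg x Ex).
  by apply: cvg_trans; apply: near_eq_cvg; near=> y; apply: esym; near: y.
split=> [x /H[E [g [oE Ex fg [dg _]]]]|v].
  by apply: near_eq_differentiable (dg _ Ex); exact: near_open fg.
apply: IH => x /H[E [g [oE Ex fg [dg cg]]]].
exists E, ('D_v g); split => //; last exact: cg.
move=> y Ey; by apply: near_eq_derive; exact: near_open fg.
Unshelve. all: by end_near. Qed.

Lemma Ck_eq V W k (D : set V) (f g : V -> W) : open D ->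
  (forall x, D x -> f x = g x) -> Ck k D g -> Ck k D f.
Proof. by move=> oD fg cg; apply: Ck_local => x Dx; exists D, g. Qed.

Lemma Ck_sub V W k (D E : set V) (f : V -> W) :
  D `<=` E -> Ck k E f -> Ck k D f.
Proof.
elim: k f => [|k IH] f DE /=; first by move=> H x /DE; exact: H.
by move=> [df cf]; split=> [x /DE|v]; [exact: df | exact: IH].
Qed.

(** Induction step for the closure properties: the directional derivatives are
    only computed on [D], which suffices by locality. *)
Lemma CkS V W k (D : set V) (f : V -> W) (df : V -> V -> W) : open D ->
  (forall x, D x -> differentiable f x) ->
  (forall v x, D x -> 'D_v f x = df v x) ->
  (forall v, Ck k D (df v)) -> Ck k.+1 D f.
Proof. by move=> oD dif Hd Hk; split => // v; exact: Ck_eq (Hd v) (Hk v). Qed.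

Lemma Ck_pred V W k (D : set V) (f : V -> W) : Ck k.+1 D f -> Ck k D f.
Proof.
elim: k f => [|k IH] f [df cf].
  by move=> x Dx; apply: differentiable_continuous; exact: df.
by split => // v; exact: IH.
Qed.

Lemma Ck_differentiable V W k (D : set V) (f : V -> W) x :
  Ck k.+1 D f -> D x -> differentiable f x.
Proof. by move=> [df _]; exact: df. Qed.

Lemma Ck_derive V W k (D : set V) (f : V -> W) v :
  Ck k.+1 D f -> Ck k D ('D_v f).
Proof. by move=> [_ cf]; exact: cf. Qed.

Lemma Ck_cst V W k (D : set V) (a : W) : open D -> Ck k D (fun=> a).
Proof.
elim: k a => [|k IH] a oD; first by move=> x _; exact: cvg_cst.
apply: (@CkS _ _ _ _ _ (fun _ _ => 0)) => //.
- by move=> v x _; rewrite derive_cst.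
- by move=> v; exact: (IH 0).
Qed.

Lemma Ck_add V W k (D : set V) (f g : V -> W) : open D ->
  Ck k D f -> Ck k D g -> Ck k D (fun x => f x + g x).
Proof.
move=> oD; elim: k f g => [|k IH] f g cf cg.
  by move=> x Dx; apply: continuousD; [exact: cf | exact: cg].
have [df _] := cf; have [dg _] := cg.
apply: (@CkS _ _ _ _ _ (fun v x => 'D_v f x + 'D_v g x)) => //.
- by move=> x Dx; apply: differentiableD; [exact: df | exact: dg].
- move=> v x Dx; rewrite -deriveD //; apply: diff_derivable;
  by [exact: df | exact: dg].
- by move=> v; apply: IH; exact: Ck_derive.
Qed.

Lemma Ck_sum V W k (D : set V) (I : Type) (r : seq I) (f : I -> V -> W) :
  open D -> (forall i, Ck k D (f i)) -> Ck k D (fun x => \sum_(i <- r) f i x).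
Proof.
move=> oD cf; elim: r => [|i r IH].
  by apply: (@Ck_eq _ _ _ _ _ (fun=> 0)) => // [x _|]; rewrite ?big_nil//; exact: Ck_cst.
apply: (@Ck_eq _ _ _ _ _ (fun x => f i x + \sum_(i <- r) f i x)) => //.
  by move=> x _; rewrite big_cons.
exact: Ck_add.
Qed.

Lemma Ck_mul V k (D : set V) (f g : V -> R) : open D ->
  Ck k D f -> Ck k D g -> Ck k D (fun x => f x * g x).
Proof.
move=> oD; elim: k f g => [|k IH] f g cf cg.
  by move=> x Dx; apply: continuousM; [exact: cf | exact: cg].
have [df _] := cf; have [dg _] := cg.
apply: (@CkS _ _ _ _ _ (fun v x => f x * 'D_v g x + g x * 'D_v f x)) => //.
- by move=> x Dx; apply: differentiableM; [exact: df | exact: dg].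
- move=> v x Dx; rewrite -[RHS]deriveM //; apply: diff_derivable;
  by [exact: df | exact: dg].
- by move=> v; apply: Ck_add => //; apply: IH;
    (exact: Ck_derive || exact: Ck_pred).
Qed.

Lemma Ck_linear V W (W' : normedModType R) k (D : set V) (L : {linear W -> W'})
    (f : V -> W) : open D -> continuous L -> Ck k D f -> Ck k D (fun x => L (f x)).
Proof.
move=> oD cL; elim: k f => [|k IH] f cf.
  by move=> x Dx; apply: continuous_comp; [exact: cf | exact: cL].
have [df _] := cf.
have dL y : differentiable L y by exact: linear_differentiable.
apply: (@CkS _ _ _ _ _ (fun v x => L ('D_v f x))) => //.
- by move=> x Dx; apply: (@differentiable_comp _ _ _ _ f) => //; exact: df.
- move=> v x Dx; rewrite !deriveE //; [|exact: df|].
    rewrite (@diff_comp _ _ _ _ f) //=; last exact: df.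
    by rewrite diff_lin.
  by apply: (@differentiable_comp _ _ _ _ f) => //; exact: df.
- by move=> v; apply: IH; exact: Ck_derive.
Qed.

Lemma Ck_coord V n k (D : set V) (f : V -> 'rV[R]_n) j : open D ->
  Ck k D f -> Ck k D (fun x => f x 0 j).
Proof.
move=> oD cf.
have lin : linear (fun y : 'rV[R]_n => y 0 j : R) by move=> a y z; rewrite !mxE.
pose L : {linear 'rV[R]_n -> R} := HB.pack (fun y : 'rV[R]_n => y 0 j : R)
  (GRing.isLinear.Build _ _ _ _ _ lin).
by apply: (@Ck_linear _ _ _ _ _ L) => //; exact: coord_continuous.
Qed.

Lemma derive_sum_coord V n (F : 'rV[R]_n -> V) x v : differentiable F x ->
  'D_v F x = \sum_j v 0 j *: 'D_(delta_mx 0 j) F x.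
Proof.
move=> dF; rewrite deriveE // [in LHS](row_sum_delta v) linear_sum.
by apply: eq_bigr => j _; rewrite linearZ deriveE.
Qed.

Lemma derive_coord V n (f : V -> 'rV[R]_n) x v j : differentiable f x ->
  'D_v (fun y => f y 0 j) x = ('D_v f x) 0 j.
Proof.
move=> df; pose g := fun y : 'rV[R]_n => y 0 j : R.
have dg y : differentiable g y by exact: differentiable_coord.
have lin : linear g by move=> a y z; rewrite /g !mxE.
pose L : {linear 'rV[R]_n -> R} := HB.pack g (GRing.isLinear.Build _ _ _ _ _ lin).
rewrite !deriveE //; last exact: (@differentiable_comp _ _ _ _ f g).
rewrite (@diff_comp _ _ _ _ f g) //=.
by rewrite (@diff_lin _ _ _ L) //; exact: coord_continuous.
Qed.

Lemma derive_comp_rV V W n (f : V -> 'rV[R]_n) (F : 'rV[R]_n -> W) x v :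
  differentiable f x -> differentiable F (f x) ->
  'D_v (F \o f) x = \sum_j ('D_v f x) 0 j *: 'D_(delta_mx 0 j) F (f x).
Proof.
move=> df dF; rewrite -(derive_sum_coord ('D_v f x) dF) (deriveE _ dF).
rewrite deriveE; last exact: differentiable_comp.
by rewrite diff_comp //= deriveE.
Qed.

(** The chain rule expresses a derivative of a composite through the partial
    derivatives of the outer function, which are again composites with the same
    inner function; hence the induction on [k]. *)
Lemma Ck_comp V n k (D : set V) (E : set 'rV[R]_n) (f : V -> 'rV[R]_n)
    (F : 'rV[R]_n -> R) : open D -> open E -> (forall x, D x -> E (f x)) ->
  Ck k D f -> Ck k E F -> Ck k D (F \o f).
Proof.
move=> oD oE DE; elim: k F => [|k IH] F cf cF.
  by move=> x Dx; apply: continuous_comp; [exact: cf | apply: cF; exact: DE].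
have [df _] := cf; have [dF _] := cF.
apply: (@CkS _ _ _ _ _
  (fun v x => \sum_j ('D_v f x) 0 j * ('D_(delta_mx 0 j) F \o f) x)) => //.
- by move=> x Dx; apply: differentiable_comp; [exact: df | apply: dF; exact: DE].
- move=> v x Dx; rewrite derive_comp_rV //; [exact: df | apply: dF; exact: DE].
- move=> v; apply: Ck_sum => // j; apply: Ck_mul => //.
    by apply: Ck_coord => //; exact: Ck_derive.
  by apply: IH; [exact: Ck_pred | exact: Ck_derive].
Qed.

Lemma derive_compR V (f : V -> R) (h : R -> R) x v :
  differentiable f x -> differentiable h (f x) ->
  'D_v (h \o f) x = 'D_v f x * 'D_1 h (f x).
Proof.
move=> df dh; rewrite deriveE; last exact: differentiable_comp.
by rewrite diff_comp //= (diff1E dh) derive1E (deriveE _ df).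
Qed.

Lemma Ck_compR V k (D : set V) (E : set R) (f : V -> R)
    (h : R -> R) : open D -> open E -> (forall x, D x -> E (f x)) ->
  Ck k D f -> Ck k E h -> Ck k D (h \o f).
Proof.
move=> oD oE DE; elim: k h => [|k IH] h cf ch.
  by move=> x Dx; apply: continuous_comp; [exact: cf | apply: ch; exact: DE].
have [df _] := cf; have [dh _] := ch.
apply: (@CkS _ _ _ _ _ (fun v x => 'D_v f x * ('D_1 h \o f) x)) => //.
- by move=> x Dx; apply: differentiable_comp; [exact: df | apply: dh; exact: DE].
- by move=> v x Dx; apply: derive_compR; [exact: df | apply: dh; exact: DE].
- move=> v; apply: Ck_mul => //; first exact: Ck_derive.
  by apply: IH; [exact: Ck_pred | exact: Ck_derive].
Qed.

Lemma Ck_inv V k (D : set V) (f : V -> R) : open D ->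
  (forall x, D x -> f x != 0) -> Ck k D f -> Ck k D (fun x => (f x)^-1).
Proof.
move=> oD f0; elim: k => [|k IH] cf.
  by move=> x Dx; apply: continuousV; [exact: f0 | exact: cf].
have [df _] := cf; have ck := Ck_pred cf.
apply: (@CkS _ _ _ _ _ (fun v x => - 1 * ((f x)^-1 * (f x)^-1 * 'D_v f x))) => //.
- by move=> x Dx; apply: differentiableV; [exact: df | exact: f0].
- move=> v x Dx; rewrite deriveV //; [|exact: f0|exact/diff_derivable/df].
  by rewrite mulN1r -invfM -expr2 -mulNr.
- move=> v; apply: Ck_mul => //; first exact: Ck_cst.
  by do !apply: Ck_mul => //; [exact: IH|exact: IH|exact: Ck_derive].
Qed.

End Ck.

(** * Linear ordinary differential equations on the unit interval *)

Section UnitInterval.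
Context {R : realType}.
Implicit Types (f g F : R -> R) (s t : R).

Definition clamp t : R := Num.max 0 (Num.min t 1).

Lemma clamp_in t : 0 <= clamp t <= 1.
Proof. by rewrite /clamp le_max lexx /= ge_max ler01 /= ge_min lexx orbT. Qed.

Lemma clamp_id t : 0 <= t <= 1 -> clamp t = t.
Proof. by move=> /andP[t0 t1]; rewrite /clamp min_l// max_r. Qed.

Lemma clamp_continuous : continuous clamp.
Proof.
have cm : continuous (fun t : R => Num.min t 1).
  by apply: (@min_fun_continuous _ R R id (cst 1)) => t;
    [exact: cvg_id | exact: cvg_cst].
by apply: (@max_fun_continuous _ R R (cst 0) _ _ cm) => t; exact: cvg_cst.
Qed.

Lemma mvt_bound f (df : R -> R) (d t : R) : 0 <= t <= 1 ->
  {within `[0, t], continuous f} ->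
  (forall s, 0 < s < 1 -> is_derive s 1 f (df s)) ->
  (forall s, 0 < s < 1 -> `|df s| <= d) -> `|f t - f 0| <= d.
Proof.
move=> /andP[t0 t1] cf Df bd.
have d0 : 0 <= d.
  have h : 0 < (2^-1 : R) < 1 by lra.
  exact: le_trans (normr_ge0 _) (bd _ h).
have [->|tn0] := eqVneq t 0; first by rewrite subrr normr0.
have tp : 0 < t by rewrite lt_neqAle eq_sym tn0.
have [|c] := @MVT R f df 0 t tp _ cf.
  by move=> s; rewrite in_itv /= => /andP[s0 st]; apply: Df; rewrite s0 (lt_le_trans st).
rewrite in_itv /= => /andP[c0 ct] ->; rewrite subr0 normrM (ger0_norm t0).
rewrite -[leRHS]mulr1; apply: ler_pM => //; apply: bd.
by rewrite c0 (lt_le_trans ct).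
Qed.

(** Freezing the primitive outside of the unit interval keeps all functions
    continuous on the whole line, so that taking primitives can be iterated.
    The integral starts at -1 to have a derivative at the endpoint 0. *)
Lemma primitive01 f : continuous f -> exists F,
  [/\ continuous F, F 0 = 0, forall t, F t = F (clamp t) &
      forall t, 0 < t < 1 -> is_derive t 1 F (f t)].
Proof.
move=> cf.
pose G := fun t => (\int[lebesgue_measure]_(s in `[-1, t]) f s)%R.
have intf : lebesgue_measure.-integrable `[-1, 2] (EFin \o f).
  apply: continuous_compact_integrable; first exact: segment_compact.
  exact: continuous_subspaceT.
have dG t : -1 < t < 2 -> is_derive t 1 G (f t).
  move=> /andP[t1 t2].
  have [d1 d2] := continuous_FTC1_closed t2 intf t1 (cf t).
  by apply: DeriveDef; [exact: d1 | rewrite -derive1E; exact: d2].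
have c01 s : -1 < clamp s < 2.
  have /andP[a b] := clamp_in s; apply/andP; split.
    by apply: lt_le_trans a; rewrite ltrN10.
  by apply: le_lt_trans b _; rewrite ltr1n.
exists (fun t => G (clamp t) - G 0); split.
- have cG : continuous (G \o clamp).
    move=> t; apply: continuous_comp; first exact: clamp_continuous.
    apply: differentiable_continuous; apply/derivable1_diffP.
    by have [] := dG _ (c01 t).
  by move=> t; exact: (cvgB (cG t) (cvg_cst _)).
- by rewrite clamp_id ?lexx ?ler01 // subrr.
- by move=> t; rewrite [in RHS]clamp_id // clamp_in.
- move=> t /andP[t0 t1].
  have dGt : is_derive t 1 G (f t).
    by apply: dG; rewrite (lt_trans _ t0) ?ltrN10//= (lt_trans t1)// ltr1n.
  have : is_derive t 1 (fun t => G t - G 0) (f t).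
    by apply: is_derive_eq; rewrite subr0.
  apply: near_eq_is_derive; near=> s.
  have : s \in `]0, 1[ by near: s; apply: near_in_itvoo; rewrite in_itv /= t0.
  by rewrite in_itv /= => /andP[s0 s1]; rewrite clamp_id // !ltW.
Unshelve. all: by end_near. Qed.

(** The intervals of radius 2C/2^k around [u k] are nested. *)
Lemma geometric_limit (u : nat -> R) (C : R) :
  (forall k, `|u k.+1 - u k| <= C / 2 ^+ k) ->
  exists l, forall k, `|l - u k| <= 2 * C / 2 ^+ k.
Proof.
move=> H.
have C0 : 0 <= C.
  by have := le_trans (normr_ge0 _) (H 0%N); rewrite expr0 divr1.
pose v k := u k - 2 * C / 2 ^+ k; pose w k := u k + 2 * C / 2 ^+ k.
have half k : C / 2 ^+ k = 2 * (C / 2 ^+ k.+1).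
  by rewrite exprS invfM; field; rewrite expf_neq0.
have vS k : v k <= v k.+1.
  have := H k; rewrite ler_norml /v -!mulrA half => /andP[+ _].
  lra.
have wS k : w k.+1 <= w k.
  have := H k; rewrite ler_norml /w -!mulrA half => /andP[_].
  lra.
have vm := homo_leq (@lexx _ _) (@le_trans _ _) vS.
have wm : forall i j, (i <= j)%N -> w j <= w i.
  by apply: (@homo_leq _ _ (fun x y => y <= x)) => // x y z h1 h2; exact: le_trans h2 h1.
have vw j k : v j <= w k.
  apply: le_trans (vm _ _ (leq_maxl j k)) _; apply: le_trans (wm _ _ (leq_maxr j k)).
  have : 0 <= 2 * C / 2 ^+ (maxn j k) by rewrite divr_ge0 ?mulr_ge0 ?exprn_ge0.
  rewrite /v /w; lra.
exists (sup (range v)) => k.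
have vl : v k <= sup (range v).
  apply: ub_le_sup; last by exists k.
  by exists (w 0%N) => _ [j _ <-]; exact: vw.
have lw : sup (range v) <= w k.
  apply: ge_sup; first by exists (v 0%N), 0%N.
  by move=> _ [j _ <-]; exact: vw.
by move: vl lw; rewrite /v /w ler_distl; lra.
Qed.

Lemma geometric_small (C e : R) : 0 < e -> exists k, C / 2 ^+ k <= e.
Proof.
move=> e0; exists (Num.bound (C / e)).
rewrite ler_pdivrMr ?exprn_gt0 // mulrC -ler_pdivrMr //.
by apply: ltW; exact: upper_nthrootP.
Qed.

Lemma continuous_uniform_approx f :
  (forall e, 0 < e -> exists2 g, continuous g & forall t, `|f t - g t| <= e) ->
  continuous f.
Proof.
move=> H t; apply/cvgrPdist_le => e e0.
have e3 : 0 < e / 3 by rewrite divr_gt0.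
have [g cg fg] := H _ e3.
have /cvgrPdist_le/(_ _ e3) gt := cg t.
near=> s.
have h1 := fg t; have h2 := fg s; have h3 : `|g t - g s| <= e / 3 by near: s.
have -> : f t - f s = (f t - g t) + (g t - g s) + (g s - f s) by ring.
apply: le_trans (ler_normD _ _) _; rewrite [`|g s - _|]distrC.
apply: le_trans (lerD (ler_normD _ _) (lexx _)) _; lra.
Unshelve. all: by end_near. Qed.

End UnitInterval.

Lemma continuous_bigsum {R : realType} {T : topologicalType} (I : Type)
    (r : seq I) (F : I -> T -> R) :
  (forall i, continuous (F i)) -> continuous (fun t => \sum_(i <- r) F i t).
Proof.
move=> cF; elim: r => [|i r IH].
  rewrite (_ : (fun _ => _) = cst 0); first by move=> t; exact: cvg_cst.
  by apply/funext => t; rewrite big_nil.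
rewrite (_ : (fun _ => _) = F i + (fun t => \sum_(i <- r) F i t)).
  by move=> t; apply: cvgD; [exact: cF | exact: IH].
by apply/funext => t; rewrite big_cons.
Qed.

Section LinearODE.
Context {R : realType} {J : finType}.
Local Notation N := (#|J|%:R : R).
Implicit Types (a b : J) (s t : R).

Lemma ler_sum_card (F : J -> R) c : (forall a, F a <= c) -> \sum_a F a <= N * c.
Proof.
move=> H; apply: le_trans (ler_sum _ (fun a _ => H a)) _.
by rewrite big_const iter_addr addr0 mulr_natl.
Qed.

Lemma ler_sum_mul (b Y : J -> R) c d : 0 <= c ->
  (forall a, `|b a| <= c) -> (forall a, `|Y a| <= d) ->
  `|\sum_a b a * Y a| <= N * (c * d).
Proof.
move=> c0 bb bY; apply: le_trans (ler_norm_sum _ _ _) _.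
by apply: ler_sum_card => a; rewrite normrM ler_pM.
Qed.

(** The sum of the |Z a| has a maximum [m] on the unit interval, and the mean
    value theorem gives m <= m / 2 + N (eta + eps); the smallness of [beta] thus
    replaces the exponential of the usual inequality. *)
Lemma gronwall01 (Z dZ : J -> R -> R) (beta eta eps : R) : 0 <= beta ->
  N * beta <= 1 / 2 ->
  (forall a, continuous (Z a)) -> (forall a, `|Z a 0| <= eta) ->
  (forall a t, 0 < t < 1 -> is_derive t 1 (Z a) (dZ a t)) ->
  (forall a t, 0 < t < 1 -> `|dZ a t| <= beta * \sum_b `|Z b t| + eps) ->
  forall t, 0 <= t <= 1 -> \sum_a `|Z a t| <= 2 * N * (eta + eps).
Proof.
move=> beta0 Nb cZ Z0 DZ bZ t t01.
have cS : continuous (fun t => \sum_a `|Z a t|).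
  apply: continuous_bigsum => a s.
  by apply: (@continuous_comp _ _ _ (Z a)); [exact: cZ | exact: norm_continuous].
have [c c01 mc] := EVT_max (@ler01 R) (continuous_subspaceT cS).
apply: le_trans (mc t _) _; first by rewrite in_itv.
move: c01; rewrite in_itv /= => c01.
set m := \sum_a `|Z a c|.
have mE s : 0 < s < 1 -> \sum_b `|Z b s| <= m.
  by move=> /andP[s0 s1]; apply: mc; rewrite in_itv /= !ltW.
have bnd a : `|Z a c| <= eta + (beta * m + eps).
  rewrite -(subrK (Z a 0) (Z a c)) addrC; apply: le_trans (ler_normD _ _) _.
  apply: lerD => //; apply: (mvt_bound c01 _ (DZ a)).
    exact: continuous_subspaceT.
  move=> s s01; apply: le_trans (bZ _ _ s01) _.
  by rewrite lerD2r ler_wpM2l // mE.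
have := ler_sum_card bnd; rewrite -/m !mulrDr mulrA => H.
have m0 : 0 <= m by apply: sumr_ge0.
have : N * beta * m <= 1 / 2 * m by rewrite ler_wpM2r.
move: H; lra.
Qed.

(** Picard iteration: the smallness of the coefficients makes the integral
    operator [T] a contraction of ratio 1/2 on the whole unit interval. *)
Lemma linear_ode (B : J -> J -> R -> R) (beta : R) : 0 <= beta ->
  N * beta <= 1 / 2 ->
  (forall a b, continuous (B a b)) -> (forall a b t, `|B a b t| <= beta) ->
  forall y0 : J -> R, exists Y : J -> R -> R,
  [/\ forall a, continuous (Y a), forall a, Y a 0 = y0 a &
      forall a t, 0 < t < 1 -> is_derive t 1 (Y a) (\sum_b B a b t * Y b t)].
Proof.
move=> beta0 Nb cB bB y0.
have /choice[Q QP] : forall f : R -> R, exists F, continuous f ->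
    [/\ continuous F, F 0 = 0, forall t, F t = F (clamp t) &
      forall t, 0 < t < 1 -> is_derive t 1 F (f t)].
  move=> f; have [/primitive01[F FP]|nf] := pselect (continuous f).
    by exists F.
  by exists f.
have cBY a Y : (forall b : J, continuous (Y b)) ->
    continuous (fun t => \sum_b B a b t * Y b t).
  move=> cY; apply: continuous_bigsum => b t.
  by apply: continuousM; [exact: cB | exact: cY].
have QB f d t : continuous f -> (forall s, 0 < s < 1 -> `|f s| <= d) ->
    `|Q f t| <= d.
  move=> cf bf; have [cQ Q0 Qc dQ] := QP _ cf.
  have := mvt_bound (clamp_in t) (continuous_subspaceT cQ) dQ bf.
  by rewrite Q0 subr0 -Qc.
have QD f g d t : continuous f -> continuous g ->
    (forall s, 0 < s < 1 -> `|f s - g s| <= d) -> `|Q f t - Q g t| <= d.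
  move=> cf cg bf; have [cQ Q0 Qc dQ] := QP _ cf; have [cQ' Q0' Qc' dQ'] := QP _ cg.
  have D s : 0 < s < 1 -> is_derive s 1 (Q f - Q g) (f s - g s).
    by move=> s01; apply: is_deriveB; [exact: dQ | exact: dQ'].
  have cD : continuous (Q f - Q g).
    by move=> s; apply: continuousB; [exact: cQ | exact: cQ'].
  have := mvt_bound (clamp_in t) (continuous_subspaceT cD) D bf.
  by rewrite !fctE Q0 Q0' subrr subr0 -Qc -Qc'.
pose T (Y : J -> R -> R) a t := y0 a + Q (fun s => \sum_b B a b s * Y b s) t.
have cT Y : (forall b : J, continuous (Y b)) -> forall a, continuous (T Y a).
  move=> cY a t; apply: continuousD; first exact: cvg_cst.
  by have [cQ _ _ _] := QP _ (cBY a _ cY); exact: cQ.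
have Tcontr Y Y' d : (forall b : J, continuous (Y b)) ->
    (forall b : J, continuous (Y' b)) ->
    (forall b t, `|Y b t - Y' b t| <= d) ->
    forall a t, `|T Y a t - T Y' a t| <= d / 2.
  move=> cY cY' dY a t; rewrite /T opprD addrACA subrr add0r.
  apply: QD; [exact: cBY|exact: cBY|] => s _.
  rewrite -sumrB (eq_bigr (fun b => B a b s * (Y b s - Y' b s))); last first.
    by move=> b _; rewrite mulrBr.
  have d0 : 0 <= d by exact: le_trans (normr_ge0 _) (dY a t).
  apply: le_trans (ler_sum_mul beta0 (fun b => bB a b s) (fun b => dY b s)) _.
  have : N * beta * d <= 1 / 2 * d by rewrite ler_wpM2r.
  rewrite mulrA; lra.
pose Yk k := iter k T (fun a _ => y0 a).
have cYk k a : continuous (Yk k a).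
  by elim: k a => [|k IH] a; [move=> t; exact: cvg_cst | exact: cT].
pose C := N * (beta * \sum_a `|y0 a|).
have step k a t : `|Yk k.+1 a t - Yk k a t| <= C / 2 ^+ k.
  elim: k a t => [|k IH] a t.
    rewrite expr0 divr1 /Yk /= /T addrC addKr; apply: QB.
      by apply: cBY => b s; exact: cvg_cst.
    move=> s _; apply: ler_sum_mul => // b.
    by rewrite (bigD1 b) //= lerDl sumr_ge0.
  rewrite exprSr invfM mulrA; exact: (Tcontr _ _ _ (cYk k.+1) (cYk k) IH).
have /choice[Y YP] : forall p : J * R, exists l,
    forall k, `|l - Yk k p.1 p.2| <= 2 * C / 2 ^+ k.
  by move=> [a t]; exact: (geometric_limit (fun k => step k a t)).
have YD k a t : `|Y (a, t) - Yk k a t| <= 2 * C / 2 ^+ k by exact: (YP (a, t)).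
pose Z a t := Y (a, t).
have cZ a : continuous (Z a).
  apply: continuous_uniform_approx => e e0.
  have [k kP] := geometric_small (2 * C) e0.
  by exists (Yk k a) => // t; exact: le_trans (YD _ _ _) kP.
have fixZ a t : Z a t = T Z a t.
  apply/eqP; rewrite -subr_eq0 -normr_eq0 eq_le normr_ge0 andbT.
  apply/ler_addgt0Pl => e e0; rewrite addr0.
  have [k kP] := geometric_small (2 * C) e0.
  have YDk b s : `|Yk k b s - Z b s| <= 2 * C / 2 ^+ k by rewrite distrC; exact: YD.
  have h1 := YD k.+1 a t; have h2 := Tcontr _ _ _ (cYk k) cZ YDk a t.
  rewrite -/(Yk k.+1) in h2.
  have -> : Z a t - T Z a t = (Y (a, t) - Yk k.+1 a t) + (T (Yk k) a t - T Z a t).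
    by rewrite addrA subrK.
  apply: le_trans (ler_normD _ _) _; apply: le_trans kP.
  rewrite exprSr invfM mulrA in h1.
  lra.
exists Z; split => // [a|a t t01].
  rewrite fixZ /T; have [_ -> _ _] := QP _ (cBY a _ cZ); exact: addr0.
have [_ _ _ dQ] := QP _ (cBY a _ cZ).
have -> : Z a = cst (y0 a) + Q (fun s => \sum_b B a b s * Z b s).
  by apply/funext => s; rewrite fixZ.
have D := dQ _ t01.
by apply: is_derive_eq; rewrite add0r.
Qed.

End LinearODE.

(** * The Frobenius theorem for linear total systems *)

Section Lines.
Context {R : realType} {n : nat}.
Implicit Types (x z h w : 'rV[R]_n) (f : 'rV[R]_n -> R) (s t : R).

Lemma ler_norm_coord z i : `|z 0 i| <= `|z|.
Proof.
rewrite [leRHS]/Num.Def.normr /= mx_normrE; apply/bigmax_geP; right => /=.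
by exists (0, i).
Qed.

Lemma is_derive_line f x h t : derivable f (x + t *: h) h ->
  is_derive t 1 (fun s => f (x + s *: h)) ('D_h f (x + t *: h)).
Proof.
move=> df.
have E : (fun k : R => k^-1 *: (((fun s => f (x + s *: h)) \o shift t) (k *: 1)
    - f (x + t *: h))) =
  (fun k => k^-1 *: ((f \o shift (x + t *: h)) (k *: h) - f (x + t *: h))).
  apply/funext => k /=; congr (_ *: (f _ - _)).
  by rewrite [k *: 1]mulr1 scalerDl addrCA.
by apply: DeriveDef; rewrite /derivable /derive E.
Qed.

Lemma ball_segment x0 x h (r t : R) : `|x - x0| < r -> `|x + h - x0| < r ->
  0 <= t <= 1 -> `|x + t *: h - x0| < r.
Proof.
move=> xr hr /andP[t0 t1].
have -> : x + t *: h - x0 = (1 - t) *: (x - x0) + t *: (x + h - x0).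
  rewrite [x + h - x0]addrAC [LHS]addrAC; move: (x - x0) => u.
  by rewrite scalerBl scale1r scalerDr addrA subrK.
apply: le_lt_trans (ler_normD _ _) _; rewrite !normrZ (ger0_norm t0).
rewrite ger0_norm ?subr_ge0 //.
have [->|tn0] := eqVneq t 0; first by rewrite subr0 mul0r addr0 mul1r.
have tp : 0 < t by rewrite lt_neqAle eq_sym tn0.
have -> : r = (1 - t) * r + t * r by ring.
apply: ler_ltD; last by rewrite ltr_pM2l.
by rewrite ler_wpM2l ?subr_ge0 // ltW.
Qed.

Section OnBall.
Variables (x0 : 'rV[R]_n) (r : R) (f : 'rV[R]_n -> R).
Hypothesis df : forall x, `|x - x0| < r -> differentiable f x.

Let dline x h s : `|x - x0| < r -> `|x + h - x0| < r -> 0 <= s <= 1 ->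
  is_derive s 1 (fun s => f (x + s *: h)) ('D_h f (x + s *: h)).
Proof.
move=> xr hr s01; apply: is_derive_line; apply: diff_derivable; apply: df.
exact: ball_segment.
Qed.

Let cline x h : `|x - x0| < r -> `|x + h - x0| < r ->
  {within `[0, 1], continuous (fun s => f (x + s *: h))}.
Proof.
move=> xr hr; apply: derivable_within_continuous => s; rewrite in_itv /= => s01.
by have [] := dline xr hr s01.
Qed.

Lemma lipschitz_of_derive K : (forall x h, `|x - x0| < r -> `|'D_h f x| <= K * `|h|) ->
  forall x h, `|x - x0| < r -> `|x + h - x0| < r -> `|f (x + h) - f x| <= K * `|h|.
Proof.
move=> bf x h xr hr.
have := @mvt_bound R _ (fun s => 'D_h f (x + s *: h)) (K * `|h|) 1 _ (cline xr hr).
rewrite scale1r scale0r addr0; apply.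
- by rewrite ler01 lexx.
- by move=> s /andP[s0 s1]; apply: dline => //; rewrite !ltW.
- move=> s /andP[s0 s1]; apply: bf; apply: ball_segment => //; by rewrite !ltW.
Qed.

(** Mean value theorem for [f (x + s *: h) - s * 'D_h f x] on the unit
    interval. *)
Lemma taylor_of_derive K :
  (forall x h s, `|x - x0| < r -> `|x + h - x0| < r -> 0 <= s <= 1 ->
    `|'D_h f (x + s *: h) - 'D_h f x| <= K * `|h| ^+ 2) ->
  forall x h, `|x - x0| < r -> `|x + h - x0| < r ->
   `|f (x + h) - f x - 'D_h f x| <= K * `|h| ^+ 2.
Proof.
move=> bf x h xr hr; pose c := 'D_h f x.
pose g := (fun s => f (x + s *: h)) - (fun s => s * c).
have dg s : 0 <= s <= 1 -> is_derive s 1 g ('D_h f (x + s *: h) - c).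
  move=> s01; apply: is_deriveB; first exact: dline.
  have : is_derive s 1 (id * cst c : R -> R) (s *: 0 + c *: 1).
    by apply: is_deriveM.
  by move=> H; apply: is_derive_eq H _; rewrite scaler0 add0r [_ *: _]mulr1.
have cg : {within `[0, 1], continuous g}.
  apply: derivable_within_continuous => s; rewrite in_itv /= => s01.
  by have [] := dg _ s01.
have -> : f (x + h) - f x - 'D_h f x = g 1 - g 0.
  by rewrite /g !fctE scale1r scale0r addr0 mul1r mul0r subr0 addrAC.
apply: (mvt_bound (df := fun s => 'D_h f (x + s *: h) - c) _ cg).
- by rewrite ler01 lexx.
- by move=> s /andP[s0 s1]; apply: dg; rewrite !ltW.
- by move=> s /andP[s0 s1]; apply: bf => //; rewrite !ltW.
Qed.

End OnBall.

End Lines.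

Section TotalSystem.
Context {R : realType} {n : nat} {J : finType}.
Local Notation N := (#|J|%:R : R).
Local Notation vec := ('rV[R]_n).
Implicit Types (x z w h : vec) (a b c : J) (s t : R).

(** Data of the linear total system 'D_h y_a = \sum_b A h a b * y_b on a ball:
    the direction [h] is contracted into the coefficients, so that restricting
    the system to the ray in the direction [z] amounts to taking [A z]. The
    bound [sts_small] makes the equation along every ray of the ball a
    contraction on [0, 1], and [sts_integrable] is the symmetry of the second
    derivatives of a solution. *)
Record small_total_system (A : vec -> J -> J -> vec -> R) (x0 : vec) (r K : R) :
    Prop := SmallTotalSystem {
  sts_r1 : r <= 1 ;
  sts_K0 : 0 <= K ;
  sts_small : N * (K * r) <= 1 / 2 ;
  sts_add : forall z w a b x, A (z + w) a b x = A z a b x + A w a b x ;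
  sts_diff : forall z a b x, `|x - x0| < r -> differentiable (A z a b) x ;
  sts_bound : forall z a b x, `|x - x0| < r -> `|A z a b x| <= K * `|z| ;
  sts_lip : forall z a b x h, `|x - x0| < r -> `|x + h - x0| < r ->
    `|A z a b (x + h) - A z a b x| <= K * `|z| * `|h| ;
  sts_taylor : forall z a b x h, `|x - x0| < r -> `|x + h - x0| < r ->
    `|A z a b (x + h) - A z a b x - 'D_h (A z a b) x| <= K * `|z| * `|h| ^+ 2 ;
  sts_derive : forall z a b x h, `|x - x0| < r ->
    `|'D_h (A z a b) x| <= K * `|z| * `|h| ;
  sts_integrable : forall z w a b x, `|x - x0| < r ->
    'D_z (A w a b) x + \sum_c A w a c x * A z c b x =
    'D_w (A z a b) x + \sum_c A z a c x * A w c b x }.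

Lemma sum_mul_swap (F : J -> R) (H : J -> J -> R) (Y : J -> R) :
  \sum_b F b * (\sum_c H b c * Y c) = \sum_c (\sum_b F b * H b c) * Y c.
Proof.
under eq_bigr do rewrite mulr_sumr; rewrite exchange_big /=.
apply: eq_bigr => c _; rewrite mulr_suml; apply: eq_bigr => b _.
by rewrite mulrA.
Qed.

Lemma is_derive_bigsum (I : Type) (r : seq I) (F : I -> R -> R) (dF : I -> R) t :
  (forall i, is_derive t 1 (F i) (dF i)) ->
  is_derive t 1 (fun s => \sum_(i <- r) F i s) (\sum_(i <- r) dF i).
Proof.
move=> H; elim: r => [|i r IH].
  rewrite big_nil (_ : (fun _ => _) = cst 0); first exact: is_derive_cst.
  by apply/funext => s; rewrite big_nil.
rewrite big_cons (_ : (fun _ => _) = F i + (fun s => \sum_(i <- r) F i s)).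
  exact: is_deriveD.
by apply/funext => s; rewrite big_cons.
Qed.

Lemma is_derive_mul (f g : R -> R) (df dg : R) t :
  is_derive t 1 f df -> is_derive t 1 g dg ->
  is_derive t 1 (fun s => f s * g s) (df * g t + f t * dg).
Proof.
move=> Df Dg; have H : is_derive t 1 (f * g) (f t *: dg + g t *: df).
  exact: is_deriveM.
by apply: is_derive_eq H _; rewrite addrC [_ *: df]mulrC.
Qed.

Section Rays.
Variables (A : vec -> J -> J -> vec -> R) (x0 : vec) (r K : R).
Hypothesis S : small_total_system A x0 r K.

Let ray z t := x0 + t *: z.

Let ray_in z t : `|z| < r -> 0 <= t <= 1 -> `|ray z t - x0| < r.
Proof.
move=> zr /andP[t0 t1]; rewrite /ray addrAC subrr add0r normrZ ger0_norm //.
by apply: le_lt_trans zr; rewrite ler_piMl.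
Qed.

Let r_gt0 z : `|z| < r -> 0 < r. Proof. exact: le_lt_trans. Qed.

Let z_le1 z : `|z| < r -> `|z| <= 1.
Proof. by move=> zr; apply: ltW; apply: lt_le_trans zr _; exact: sts_r1 S. Qed.

(** Freezing the coefficients for t outside of [0, 1] keeps them continuous
    although the ray leaves the ball. *)
Let coef z w a b t := A w a b (ray z (clamp t)).

Let coef_id z w a b t : 0 < t < 1 -> coef z w a b t = A w a b (ray z t).
Proof. by move=> /andP[t0 t1]; rewrite /coef clamp_id // !ltW. Qed.

Let coef_continuous z w a b : `|z| < r -> continuous (coef z w a b).
Proof.
move=> zr t.
apply: (@continuous_comp _ _ _ clamp (fun s => A w a b (ray z s))).
  exact: clamp_continuous.
apply: (@continuous_comp _ _ _ (ray z) (A w a b)).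
  apply: (@cvgD _ _ _ _ _ (fun=> x0)); first exact: cvg_cst.
  exact: scalel_continuous.
apply: differentiable_continuous; apply: sts_diff S _ _ _ _ _.
exact/ray_in/clamp_in.
Qed.

Let coef_bound z w a b t : `|z| < r -> `|coef z w a b t| <= K * `|w|.
Proof. by move=> zr; apply: sts_bound S _ _ _ _ _; exact/ray_in/clamp_in. Qed.

Let coef_derive z w a b t : `|z| < r -> 0 < t < 1 ->
  is_derive t 1 (coef z w a b) ('D_z (A w a b) (ray z t)).
Proof.
move=> zr t01.
have t01' : 0 <= t <= 1 by case/andP: t01 => t0 t1; rewrite !ltW.
have : is_derive t 1 (fun s => A w a b (x0 + s *: z)) ('D_z (A w a b) (ray z t)).
  apply: is_derive_line; apply: diff_derivable; apply: sts_diff S _ _ _ _ _.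
  exact: ray_in.
apply: near_eq_is_derive; near=> s; rewrite coef_id //.
have : s \in `]0, 1[ by near: s; apply: near_in_itvoo; rewrite in_itv.
by rewrite in_itv.
Unshelve. all: by end_near. Qed.

Let beta_small : N * (K * r) <= 1 / 2. Proof. exact: sts_small S. Qed.

Let beta_ge0 z : `|z| < r -> 0 <= K * r.
Proof. by move=> /r_gt0 r0; rewrite mulr_ge0 ?(sts_K0 S)// ltW. Qed.

Let coef_beta z a b t : `|z| < r -> `|coef z z a b t| <= K * r.
Proof.
move=> zr; apply: le_trans (coef_bound _ _ _ _ zr) _.
by rewrite ler_wpM2l ?(sts_K0 S)// ltW.
Qed.

Variable y0 : J -> R.

Let ray_solution z (Y : J -> R -> R) :=
  [/\ forall a, continuous (Y a), forall a, Y a 0 = y0 a &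
      forall a t, 0 < t < 1 -> is_derive t 1 (Y a) (\sum_b coef z z a b t * Y b t)].

Let ray_solution_ex z : `|z| < r -> exists Y, ray_solution z Y.
Proof.
move=> zr; apply: (linear_ode (beta_ge0 zr) beta_small).
  by move=> a b; exact: coef_continuous.
by move=> a b t; exact: (@coef_beta z).
Qed.

Let sum_coef_le z a t (Y : J -> R) : `|z| < r ->
  `|\sum_b coef z z a b t * Y b| <= K * r * \sum_b `|Y b|.
Proof.
move=> zr; apply: le_trans (ler_norm_sum _ _ _) _; rewrite mulr_sumr.
apply: ler_sum => b _; rewrite normrM ler_wpM2r //; exact: coef_beta.
Qed.

Let Ymax := 2 * N * \sum_a `|y0 a|.

Let ray_solution_bound z Y : `|z| < r -> ray_solution z Y ->
  forall a t, 0 <= t <= 1 -> `|Y a t| <= Ymax.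
Proof.
move=> zr [cY Y0 dY] a t t01.
have h1 a' : `|Y a' 0| <= \sum_a `|y0 a|.
  by rewrite Y0 (bigD1 a') //= lerDl sumr_ge0.
have h2 a' s : 0 < s < 1 ->
  `|\sum_b coef z z a' b s * Y b s| <= K * r * \sum_b `|Y b s| + 0.
  by move=> _; rewrite addr0 sum_coef_le.
have := gronwall01 (beta_ge0 zr) beta_small cY h1 dY h2 t01.
rewrite addr0; apply: le_trans.
by rewrite (bigD1 a) //= lerDl sumr_ge0.
Qed.

(** The solutions [Y] and [Y'] along the rays in the directions z and z + w are
    compared through the defect D = Y' - Y - t A(w) Y, which vanishes at t = 0.
    By integrability the terms of first order in w cancel in its derivative:
    D' = A(z + w) D + O(|w|^2). Hence D = O(|w|^2) by the Gronwall inequality. *)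
Let ray_solution_compare : exists2 C, 0 <= C & forall z w Y Y',
  `|z| < r -> `|z + w| < r -> ray_solution z Y -> ray_solution (z + w) Y' ->
  forall a, `|Y' a 1 - Y a 1 - \sum_b A w a b (x0 + z) * Y b 1| <= C * `|w| ^+ 2.
Proof.
pose C := N * (2 * K * Ymax) + N * (2 * K * (N * (K * Ymax))).
have K0 := sts_K0 S.
have Ymax0 : 0 <= Ymax by apply: mulr_ge0; [exact: mulr_ge0 | exact: sumr_ge0].
have C0 : 0 <= C.
  by rewrite /C; apply: addr_ge0; do !apply: mulr_ge0 => //.
exists (2 * N * C); first by rewrite !mulr_ge0.
move=> z w Y Y' zr zwr SY SY' a.
have [cY Y0 dY] := SY; have [cY' Y0' dY'] := SY'.
have bY := ray_solution_bound zr SY.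
pose G a t := \sum_b coef z w a b t * Y b t.
pose dG a t := \sum_b ('D_z (A w a b) (ray z t) * Y b t +
  A w a b (ray z t) * \sum_c A z b c (ray z t) * Y c t).
pose D a t := Y' a t - Y a t - t * G a t.
pose dD a t := \sum_b A (z + w) a b (ray (z + w) t) * Y' b t -
  \sum_b A z a b (ray z t) * Y b t - (G a t + t * dG a t).
have cG a' : continuous (G a').
  apply: continuous_bigsum => b t; apply: continuousM; last exact: cY.
  exact: coef_continuous.
have cD a' : continuous (D a').
  move=> t; apply: (cvgB (cvgB (cY' a' t) (cY a' t))).
  by apply: (cvgM (@cvg_id _ _)); exact: cG.
have DG a' t : 0 < t < 1 -> is_derive t 1 (G a') (dG a' t).
  move=> t01; apply: is_derive_bigsum => b.
  have := is_derive_mul (coef_derive w a' b zr t01) (dY b t t01).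
  rewrite coef_id //; under eq_bigr do rewrite coef_id //.
  by [].
have DD a' t : 0 < t < 1 -> is_derive t 1 (D a') (dD a' t).
  move=> t01; apply: is_deriveB.
    apply: is_deriveB; [have := dY' a' t t01 | have := dY a' t t01];
    by under eq_bigr do rewrite coef_id //.
  have := is_derive_mul (is_derive_id t 1) (DG a' t t01).
  by rewrite mul1r.
have Gb a' t : 0 <= t <= 1 -> `|G a' t| <= N * (K * `|w| * Ymax).
  move=> t01; apply: ler_sum_mul; first by rewrite mulr_ge0.
    by move=> b; exact: coef_bound.
  by move=> b; exact: bY.
have dGE a' t : 0 < t < 1 -> dG a' t =
    \sum_b 'D_w (A z a' b) (ray z t) * Y b t + \sum_b A z a' b (ray z t) * G b t.
  move=> t01.
  have t01' : 0 <= t <= 1 by case/andP: t01 => t0 t1; rewrite !ltW.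
  rewrite /dG big_split /= sum_mul_swap -big_split /=.
  rewrite /G; under [X in _ = _ + X]eq_bigr => b _.
    under eq_bigr do rewrite coef_id //.
    over.
  rewrite sum_mul_swap -big_split /=; apply: eq_bigr => b _.
  by rewrite -!mulrDl (sts_integrable S) //; exact: ray_in.
(* Substitute Y' = D + Y + t G and use integrability for dG: what remains
   besides A(z + w) D is a first-order Taylor remainder times Y, and a
   difference of order w times G, itself of order w. *)
have dDE a' t : 0 < t < 1 -> dD a' t =
    \sum_b coef (z + w) (z + w) a' b t * D b t +
    (\sum_b (A (z + w) a' b (ray (z + w) t) - A (z + w) a' b (ray z t)
        - t * 'D_w (A z a' b) (ray z t)) * Y b t +
     t * \sum_b (A (z + w) a' b (ray (z + w) t) - A z a' b (ray z t)) * G b t).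
  move=> t01; rewrite /dD dGE //.
  under [in RHS]eq_bigr do rewrite coef_id //.
  have E1 : \sum_b A (z + w) a' b (ray (z + w) t) * Y' b t =
     \sum_b A (z + w) a' b (ray (z + w) t) * D b t +
     \sum_b A (z + w) a' b (ray (z + w) t) * Y b t +
     t * \sum_b A (z + w) a' b (ray (z + w) t) * G b t.
    rewrite mulr_sumr -!big_split /=; apply: eq_bigr => b _; rewrite /D; ring.
  have E2 : \sum_b (A (z + w) a' b (ray (z + w) t) - A (z + w) a' b (ray z t)
        - t * 'D_w (A z a' b) (ray z t)) * Y b t =
      \sum_b A (z + w) a' b (ray (z + w) t) * Y b t
      - \sum_b A z a' b (ray z t) * Y b t - G a' t
      - t * \sum_b 'D_w (A z a' b) (ray z t) * Y b t.
    rewrite mulr_sumr -!sumrB; apply: eq_bigr => b _.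
    by rewrite coef_id // (sts_add S _ _ _ _ (ray z t)); ring.
  have E3 : \sum_b (A (z + w) a' b (ray (z + w) t) - A z a' b (ray z t)) * G b t =
      \sum_b A (z + w) a' b (ray (z + w) t) * G b t -
      \sum_b A z a' b (ray z t) * G b t.
    by rewrite -!sumrB; apply: eq_bigr => b _; rewrite mulrBl.
  rewrite E1 E2 E3; ring.
have rayE t : ray (z + w) t = ray z t + t *: w by rewrite /ray scalerDr addrA.
have bdD a' t : 0 < t < 1 ->
    `|dD a' t| <= K * r * \sum_b `|D b t| + C * `|w| ^+ 2.
  move=> t01.
  have t01' : 0 <= t <= 1 by case/andP: t01 => t0 t1; rewrite !ltW.
  have [t0 t1] : 0 <= t /\ t <= 1 by apply/andP.
  have rz := ray_in zr t01'; have rzw := ray_in zwr t01'; rewrite rayE in rzw.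
  have tw : `|t *: w| <= `|w| by rewrite normrZ ger0_norm // ler_piMl.
  have Kz : K * `|z + w| <= K by rewrite ler_piMr // z_le1.
  have e1 b : `|A (z + w) a' b (ray (z + w) t) - A (z + w) a' b (ray z t)
        - t * 'D_w (A z a' b) (ray z t)| <= 2 * K * `|w| ^+ 2.
    have dfA v : differentiable (A v a' b) (ray z t) by exact: sts_diff S _ _ _ _ rz.
    have DA : 'D_(t *: w) (A (z + w) a' b) (ray z t) =
        t * 'D_w (A z a' b) (ray z t) + t * 'D_w (A w a' b) (ray z t).
      have -> : A (z + w) a' b = A z a' b + A w a' b.
        by apply/funext => x; rewrite (sts_add S).
      rewrite deriveE; last exact: differentiableD.
      rewrite linearZ -deriveE; last exact: differentiableD.
      by rewrite deriveD; [exact: mulrDr | exact: diff_derivable | exact: diff_derivable].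
    have := sts_taylor S (z + w) a' b rz rzw.
    rewrite DA -rayE.
    have : `|t * 'D_w (A w a' b) (ray z t)| <= K * `|w| ^+ 2.
      rewrite normrM ger0_norm //; apply: le_trans (_ : `|'D_w (A w a' b) (ray z t)| <= _).
        by rewrite ler_piMl.
      by rewrite expr2 mulrA; exact: sts_derive S _ _ _ _ _ rz.
    have : K * `|z + w| * `|t *: w| ^+ 2 <= K * `|w| ^+ 2.
      apply: ler_pM => //; first by rewrite mulr_ge0.
      by rewrite lerXn2r ?nnegrE.
    set p := A (z + w) a' b (ray (z + w) t); set q := A (z + w) a' b (ray z t).
    set u := t * 'D_w (A z a' b) (ray z t); set v := t * 'D_w (A w a' b) (ray z t).
    move=> h1 h2 h3; have -> : p - q - u = (p - q - (u + v)) + v by ring.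
    apply: le_trans (ler_normD _ _) _; lra.
  have e2 b : `|A (z + w) a' b (ray (z + w) t) - A z a' b (ray z t)| <= 2 * K * `|w|.
    have := sts_lip S (z + w) a' b rz rzw; rewrite -rayE.
    have := sts_bound S w a' b rz.
    have h0 : K * `|z + w| * `|t *: w| <= K * `|w| by apply: ler_pM => //; rewrite mulr_ge0.
    rewrite (sts_add S _ _ _ _ (ray z t)).
    set u := A (z + w) a' b (ray (z + w) t); set q := A z a' b (ray z t).
    set p := A w a' b (ray z t).
    move=> h1 h2; have -> : u - q = (u - (q + p)) + p by ring.
    apply: le_trans (ler_normD _ _) _; lra.
  rewrite dDE //; apply: le_trans (ler_normD _ _) _; apply: lerD.
    exact: sum_coef_le.
  apply: le_trans (ler_normD _ _) _.
  have s1 := ler_sum_mul (_ : 0 <= 2 * K * `|w| ^+ 2) e1 (fun b => bY b t t01').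
  have s2 := ler_sum_mul (_ : 0 <= 2 * K * `|w|) e2 (fun b => Gb b t t01').
  rewrite /C mulrDl; apply: lerD.
    apply: le_trans (s1 _) _; first by rewrite !mulr_ge0 ?exprn_ge0.
    by rewrite le_eqVlt; apply/orP; left; apply/eqP; ring.
  rewrite normrM ger0_norm //; apply: le_trans (ler_piMl _ t1) _ => //.
  apply: le_trans (s2 _) _; first by rewrite !mulr_ge0.
  by rewrite le_eqVlt; apply/orP; left; apply/eqP; ring.
have D0 a' : `|D a' 0| <= 0 by rewrite /D Y0 Y0' subrr mul0r subr0 normr0.
have o01 : 0 <= (1 : R) <= 1 by rewrite ler01 lexx.
have := gronwall01 (beta_ge0 zwr) beta_small cD D0 DD bdD o01.
rewrite add0r mulrA; apply: le_trans.
have -> : Y' a 1 - Y a 1 - \sum_b A w a b (x0 + z) * Y b 1 = D a 1.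
  rewrite /D mul1r /G; congr (_ - _); apply: eq_bigr => b _.
  by rewrite /coef clamp_id // /ray scale1r.
by rewrite (bigD1 a) //= lerDl sumr_ge0.
Qed.

(** The value at x of the solution is the value at time 1 of the solution along
    the ray from [x0] to x. The estimate says that its differential at x is
    given by the system. *)
Lemma small_total_system_solution : 0 < r -> exists y : J -> vec -> R,
  (forall a, y a x0 = y0 a) /\
  exists2 C, 0 <= C & forall x h a, `|x - x0| < r -> `|x + h - x0| < r ->
    `|y a (x + h) - y a x - \sum_b A h a b x * y b x| <= C * `|h| ^+ 2.
Proof.
move=> r0.
have /choice[Y YP] : forall z, exists Y, `|z| < r -> ray_solution z Y.
  move=> z; have [zr|_] := ltP `|z| r; last by exists (fun _ _ => 0).
  by have [Y HY] := ray_solution_ex zr; exists Y.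
exists (fun a x => Y (x - x0) a 1); split.
  move=> a; rewrite subrr.
  have z0 : `|0 : vec| < r by rewrite normr0.
  have [cY Y0 dY] := YP _ z0.
  have o01 : 0 <= (1 : R) <= 1 by rewrite ler01 lexx.
  apply/eqP; rewrite -(Y0 a) -subr_eq0 -normr_le0.
  apply: (mvt_bound o01 (continuous_subspaceT (cY a)) (dY a)) => s s01.
  rewrite big1 ?normr0 // => b _.
  have A0 x : A 0 a b x = 0.
    by have := sts_add S 0 0 a b x; rewrite addr0 => /eqP; rewrite -subr_eq0 opprD addNKr oppr_eq0 => /eqP.
  by rewrite /coef A0 mul0r.
have [C C0 H] := ray_solution_compare.
exists C => // x h a xr hr.
have hr' : `|(x - x0) + h| < r by rewrite addrAC.
have := H _ _ _ _ xr hr' (YP _ xr) (YP _ hr') a.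
by rewrite [x - x0 + h]addrAC [x0 + _]addrC subrK.
Qed.

End Rays.
End TotalSystem.

Section Frobenius.
Context {R : realType} {n : nat}.
Local Notation vec := ('rV[R]_n).
Local Notation m := (n%:R : R).
Local Notation "'e_ i" := (delta_mx 0 i : vec) (at level 8, i at level 2).
Implicit Types (x z h w : vec) (s t : R) (f : vec -> R).

Lemma lincomb_diff (I : Type) (q : seq I) (c : I -> R) (F : I -> vec -> R) x :
  (forall i, differentiable (F i) x) ->
  differentiable (fun y => \sum_(i <- q) c i * F i y) x /\
  forall h, 'D_h (fun y => \sum_(i <- q) c i * F i y) x =
    \sum_(i <- q) c i * 'D_h (F i) x.
Proof.
move=> dF; elim: q => [|i q [d1 d2]].
  rewrite (_ : (fun _ => _) = cst 0); last by apply/funext => y; rewrite big_nil.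
  by split => // h; rewrite big_nil derive_cst.
rewrite (_ : (fun _ => _) = c i *: F i + (fun y => \sum_(i <- q) c i * F i y));
  last by apply/funext => y; rewrite big_cons.
have dZ : differentiable (c i *: F i) x by exact: differentiableZ.
split; first exact: differentiableD.
move=> h; rewrite big_cons deriveD; [|exact: diff_derivable|exact: diff_derivable].
by rewrite d2 deriveZ //; exact: diff_derivable.
Qed.

Lemma sum_coord_le h (l : 'I_n -> R) L : (forall i, `|l i| <= L) ->
  `|\sum_i h 0 i * l i| <= m * L * `|h|.
Proof.
move=> lL; apply: le_trans (ler_norm_sum _ _ _) _.
apply: le_trans (ler_sum _ (_ : forall i, _ -> _ <= L * `|h|)) _.
  move=> i _; rewrite normrM mulrC; apply: ler_pM => //; exact: ler_norm_coord.
by rewrite big_const iter_addr addr0 card_ord -mulrA mulr_natl.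
Qed.

Lemma family_bounded (I : finType) (F : I -> vec -> R) x0 :
  (forall i, {for x0, continuous (F i)}) ->
  exists2 L, 0 <= L & \forall x \near x0, forall i, `|F i x| <= L.
Proof.
move=> cF; exists (\sum_i (`|F i x0| + 1)); first by apply: sumr_ge0 => i _; rewrite addr_ge0.
suff H i : \forall x \near x0, `|F i x| <= \sum_i (`|F i x0| + 1).
  exact: (@filter_forall _ _ (fun i x => `|F i x| <= _) (nbhs x0) _ H).
have /cvgrPdist_le/(_ _ (ltr01 : 0 < 1 :> R)) := cF i.
apply: filterS => x; rewrite distrC => H.
rewrite (bigD1 i) //= ; apply: le_trans (_ : `|F i x0| + 1 <= _).
  rewrite -lerBlDl; apply: le_trans H; exact: lerB_dist.
by rewrite lerDl sumr_ge0 // => j _; rewrite addr_ge0.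
Qed.

(** First and second partial derivatives are bounded near [x0] by continuity,
    and the mean value theorem turns these bounds into uniform estimates. *)
Lemma family_estimates (I : finType) (F : I -> vec -> R) (O : set vec) x0 :
  open O -> O x0 -> (forall i, Cinfty O (F i)) ->
  exists2 K, 0 <= K & exists2 r, 0 < r &
    forall x, `|x - x0| < r -> O x /\ forall i,
    [/\ differentiable (F i) x, `|F i x| <= K, forall h, `|'D_h (F i) x| <= K * `|h| &
     forall h, `|x + h - x0| < r -> `|F i (x + h) - F i x| <= K * `|h| /\
      `|F i (x + h) - F i x - 'D_h (F i) x| <= K * `|h| ^+ 2].
Proof.
move=> oO Ox0 cF.
have c0 i := cF i 0%N x0 Ox0.
have c1 (p : I * 'I_n) : {for x0, continuous ('D_('e_(p.2)) (F p.1))}.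
  exact: (Ck_derive _ (cF p.1 1%N)) Ox0.
have c2 (p : (I * 'I_n) * 'I_n) :
    {for x0, continuous ('D_('e_(p.2)) ('D_('e_(p.1.2)) (F p.1.1)))}.
  exact: (Ck_derive _ (Ck_derive _ (cF p.1.1 2%N))) Ox0.
have [L0 L00 n0] := family_bounded c0.
have [L1 L10 n1] := family_bounded c1.
have [L2 L20 n2] := family_bounded c2.
have nO : \forall x \near x0, O x by exact: near_open (fun _ H => H).
have : \forall x \near x0, [/\ O x, forall i, `|F i x| <= L0,
   forall p, `|'D_('e_(p.2)) (F p.1) x| <= L1 &
   forall p, `|'D_('e_(p.2)) ('D_('e_(p.1.2)) (F p.1.1)) x| <= L2].
  by near=> x; split; near: x.
move=> /nbhs_ballP[r /= r0 Hr].
have {}Hr x : `|x - x0| < r -> [/\ O x, forall i, `|F i x| <= L0,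
   forall p, `|'D_('e_(p.2)) (F p.1) x| <= L1 &
   forall p, `|'D_('e_(p.2)) ('D_('e_(p.1.2)) (F p.1.1)) x| <= L2].
  by move=> xr; apply: Hr; rewrite -ball_normE /= distrC.
have dF i x : `|x - x0| < r -> differentiable (F i) x.
  by move=> /Hr[Ox _ _ _]; exact: Ck_differentiable (cF i 1%N) Ox.
have dDF i j x : `|x - x0| < r -> differentiable ('D_('e_j) (F i)) x.
  by move=> /Hr[Ox _ _ _]; exact: Ck_differentiable (Ck_derive _ (cF i 2%N)) Ox.
have DF i x h : `|x - x0| < r -> `|'D_h (F i) x| <= m * L1 * `|h|.
  move=> xr; rewrite derive_sum_coord; last exact: dF.
  by have [_ _ H _] := Hr _ xr; apply: sum_coord_le => j; exact: (H (i, j)).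
have DDF i j x h : `|x - x0| < r -> `|'D_h ('D_('e_j) (F i)) x| <= m * L2 * `|h|.
  move=> xr; rewrite derive_sum_coord; last exact: dDF.
  by have [_ _ _ H] := Hr _ xr; apply: sum_coord_le => k; exact: (H (i, j, k)).
have m0 : 0 <= m by exact: ler0n.
have M1 : 0 <= m * L1 by exact: mulr_ge0.
have M2 : 0 <= m * (m * L2) by do !apply: mulr_ge0.
pose K := L0 + m * L1 + m * (m * L2).
have K0 : 0 <= K by rewrite /K !addr_ge0.
have K1 u : 0 <= u -> m * L1 * u <= K * u.
  by move=> u0; rewrite ler_wpM2r // /K; lra.
exists K => //; exists r => // x xr; have [Ox b0 _ _] := Hr _ xr.
split => // i; split.
- exact: dF.
- by apply: le_trans (b0 i) _; rewrite /K; lra.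
- by move=> h; apply: le_trans (DF _ _ _ xr) _; exact: K1.
- move=> h hr; split.
    apply: le_trans (K1 _ (normr_ge0 h)).
    exact: (lipschitz_of_derive (dF i) (DF i)).
  apply: le_trans (_ : m * (m * L2) * `|h| ^+ 2 <= _); last first.
    by rewrite ler_wpM2r ?exprn_ge0 // /K; lra.
  apply: (taylor_of_derive (dF i)) xr hr => {Ox b0} {}x {}h s xr hr s01.
  have xs := ball_segment xr hr s01.
  rewrite !derive_sum_coord; [|exact: dF|exact: dF].
  rewrite -sumrB; under eq_bigr do rewrite -mulrBr.
  rewrite [X in _ <= X](_ : _ = m * (m * L2 * `|h|) * `|h|); last first.
    by rewrite expr2; ring.
  apply: sum_coord_le => j.
  apply: le_trans (lipschitz_of_derive (dDF i j) (DDF i j) xr xs) _.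
  rewrite ler_wpM2l ?mulr_ge0 // normrZ.
  by case/andP: s01 => s0 s1; rewrite ger0_norm // ler_piMl.
Unshelve. all: by end_near. Qed.

Context {J : finType}.
Local Notation N := (#|J|%:R : R).
Implicit Types (a b c : J) (i j : 'I_n).

Definition contract (A : 'I_n -> J -> J -> vec -> R) z a b x :=
  \sum_i z 0 i * A i a b x.

Lemma contract_small (A : 'I_n -> J -> J -> vec -> R) (O : set vec) x0 :
  open O -> O x0 -> (forall i a b, Cinfty O (A i a b)) ->
  (forall i j a b x, O x ->
    'D_('e_j) (A i a b) x + \sum_c A i a c x * A j c b x =
    'D_('e_i) (A j a b) x + \sum_c A j a c x * A i c b x) ->
  exists r K, [/\ 0 < r, forall x, `|x - x0| < r -> O x &
    small_total_system (contract A) x0 r K].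
Proof.
move=> oO Ox0 cA intA.
pose F (p : 'I_n * (J * J)) := A p.1 p.2.1 p.2.2.
have [K K0 [r r0 H]] := family_estimates oO Ox0 (fun p => cA p.1 p.2.1 p.2.2 : Cinfty O (F p)).
(* On a ball of radius at most q the bound [sts_small] holds; the added 1 keeps
   the denominator positive. *)
pose q := 1 / (2 * (N * (m * K) + 1)).
have NK : 0 <= N * (m * K) by do !apply: mulr_ge0.
have q0 : 0 < q by rewrite divr_gt0 // mulr_gt0 // ltr_wpDl.
pose r' := Num.min r (Num.min 1 q).
have r'r : r' <= r by rewrite ge_min lexx.
have r'1 : r' <= 1 by rewrite !ge_min lexx orbT.
have r'q : r' <= q by rewrite !ge_min lexx !orbT.
have r'0 : 0 < r' by rewrite !lt_min r0 ltr01 q0.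
have {}H x : `|x - x0| < r' -> O x /\ forall i a b,
  [/\ differentiable (A i a b) x, `|A i a b x| <= K,
     forall h, `|'D_h (A i a b) x| <= K * `|h| &
     forall h, `|x + h - x0| < r' -> `|A i a b (x + h) - A i a b x| <= K * `|h| /\
      `|A i a b (x + h) - A i a b x - 'D_h (A i a b) x| <= K * `|h| ^+ 2].
  move=> xr; have [Ox Hx] := H x (lt_le_trans xr r'r); split => // i a b.
  have [h1 h2 h3 h4] := Hx (i, (a, b)); split => // h hr.
  by apply: h4; exact: lt_le_trans hr r'r.
have dA x a b : `|x - x0| < r' -> forall i, differentiable (A i a b) x.
  by move=> /H[_ Hx] i; have [] := Hx i a b.
have dcA x z a b : `|x - x0| < r' -> differentiable (contract A z a b) x /\
    forall h, 'D_h (contract A z a b) x = \sum_i z 0 i * 'D_h (A i a b) x.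
  by move=> xr; exact: lincomb_diff (dA _ _ _ xr).
exists r', (m * K); split => //; first by move=> x /H[].
split => //.
- by rewrite mulr_ge0.
- rewrite mulrA; apply: le_trans (_ : N * (m * K) * q <= _).
    by rewrite ler_wpM2l.
  rewrite /q [1 / (2 * _)]mul1r ler_pdivrMr; last by rewrite mulr_gt0 // ltr_wpDl.
  by move: NK; lra.
- move=> z w a b x; rewrite /contract -big_split /=; apply: eq_bigr => i _.
  by rewrite mxE mulrDl.
- by move=> z a b x /dcA => /(_ z a b)[].
- move=> z a b x xr; apply: sum_coord_le => i.
  by have [_ Hx] := H _ xr; have [] := Hx i a b.
- move=> z a b x h xr hr; rewrite /contract -sumrB.
  under eq_bigr do rewrite -mulrBr.
  rewrite [X in _ <= X](_ : _ = m * (K * `|h|) * `|z|); last by ring.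
  apply: sum_coord_le => i.
  by have [_ Hx] := H _ xr; have [_ _ _ /(_ _ hr)[]] := Hx i a b.
- move=> z a b x h xr hr; rewrite (dcA x z a b xr).2 /contract -!sumrB.
  under eq_bigr do rewrite -!mulrBr.
  rewrite [X in _ <= X](_ : _ = m * (K * `|h| ^+ 2) * `|z|); last by ring.
  apply: sum_coord_le => i.
  by have [_ Hx] := H _ xr; have [_ _ _ /(_ _ hr)[]] := Hx i a b.
- move=> z a b x h xr; rewrite (dcA x z a b xr).2.
  rewrite [X in _ <= X](_ : _ = m * (K * `|h|) * `|z|); last by ring.
  by apply: sum_coord_le => i; have [_ Hx] := H _ xr; have [] := Hx i a b.
- move=> z w a b x xr.
  have E u v : 'D_u (contract A v a b) x +
       \sum_c contract A v a c x * contract A u c b x =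
     \sum_i \sum_j v 0 i * u 0 j * ('D_('e_j) (A i a b) x +
       \sum_c A i a c x * A j c b x).
    rewrite (dcA x v a b xr).2.
    under [X in _ + X = _]eq_bigr do rewrite /contract mulr_suml.
    rewrite exchange_big -big_split /=; apply: eq_bigr => i _.
    rewrite derive_sum_coord; last exact: dA.
    under [X in _ + X = _]eq_bigr do rewrite mulr_sumr.
    rewrite exchange_big mulr_sumr -big_split /=; apply: eq_bigr => j _.
    rewrite [X in _ = X]mulrDr mulr_sumr; congr (_ + _).
      by rewrite [_ *: _]/(_ * _) mulrA.
    by apply: eq_bigr => c _; rewrite mulrACA.
  rewrite !E exchange_big; apply: eq_bigr => i _; apply: eq_bigr => j _ /=.
  by have [Ox _] := H _ xr; rewrite intA // [w 0 j * _]mulrC.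
Qed.

(** A solution of a total system is as regular as its coefficients, since all
    its first derivatives are given by the system. *)
Lemma total_system_smooth (A : 'I_n -> J -> J -> vec -> R) (D : set vec)
    (y : J -> vec -> R) : open D -> (forall i a b, Cinfty D (A i a b)) ->
  (forall a x, D x -> differentiable (y a) x) ->
  (forall i a x, D x -> 'D_('e_i) (y a) x = \sum_b A i a b x * y b x) ->
  forall a, Cinfty D (y a).
Proof.
move=> oD cA dy Dy a k; elim: k a => [|k IH] a.
  by move=> x Dx; apply: differentiable_continuous; exact: dy.
apply: (@CkS _ _ _ _ _ _ (fun v x => \sum_i v 0 i * \sum_b A i a b x * y b x)) => //.
- by move=> x Dx; exact: dy.
- move=> v x Dx; rewrite derive_sum_coord; last exact: dy.
  by apply: eq_bigr => i _; rewrite Dy.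
- move=> v; apply: Ck_sum => // i; apply: Ck_mul => //; first exact: Ck_cst.
  by apply: Ck_sum => // b; apply: Ck_mul => //; exact: cA.
Qed.

Lemma quadratic_differentiable f x (l : 'I_n -> R) (r C : R) : 0 < r -> 0 <= C ->
  (forall h, `|h| < r ->
    `|f (x + h) - f x - \sum_i h 0 i * l i| <= C * `|h| ^+ 2) ->
  differentiable f x /\ forall i, 'D_('e_i) f x = l i.
Proof.
move=> r0 C0 H.
pose g := fun h : vec => \sum_i h 0 i * l i.
have lin : linear g.
  move=> k u v; rewrite /g scaler_sumr -big_split /=; apply: eq_bigr => i _.
  by rewrite !mxE mulrDl -mulrA.
pose L : {linear vec -> R} := HB.pack g (GRing.isLinear.Build _ _ _ _ _ lin).
have cL : continuous L.
  apply: continuous_bigsum => i y; apply: continuousM; last exact: (@cst_continuous _ _ (l i)).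
  exact: coord_continuous.
have [df dE] : differentiable f x /\ 'd f x = L :> (vec -> R).
  apply: differentiable_of_estimate => // e e0.
  apply/nbhs_ballP; exists (Num.min r (e / (C + 1))) => /=.
    by rewrite lt_min r0 divr_gt0 // ltr_wpDl.
  move=> h; rewrite -ball_normE /= sub0r normrN lt_min => /andP[hr he].
  rewrite [h + x]addrC; apply: le_trans (H _ hr) _.
  rewrite expr2 mulrA ler_wpM2r //.
  move: he; rewrite ltr_pdivlMr ?ltr_wpDl // => he.
  apply: le_trans (ltW he); rewrite mulrC ler_wpM2l //; lra.
split => // i; rewrite deriveE // dE /= /g (bigD1 i) //= mxE !eqxx mul1r.
rewrite big1 ?addr0 // => j ji; by rewrite mxE (negbTE ji) andbF mul0r.
Qed.

(** Existence for overdetermined linear systems: integrate along rays, then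
    compare neighbouring rays. *)
Theorem linear_frobenius (A : 'I_n -> J -> J -> vec -> R) (O : set vec) x0 :
  open O -> O x0 -> (forall i a b, Cinfty O (A i a b)) ->
  (forall i j a b x, O x ->
    'D_('e_j) (A i a b) x + \sum_c A i a c x * A j c b x =
    'D_('e_i) (A j a b) x + \sum_c A j a c x * A i c b x) ->
  forall y0 : J -> R, exists D (y : J -> vec -> R),
  [/\ open D, D x0, D `<=` O, forall a, Cinfty D (y a) &
      (forall a, y a x0 = y0 a) /\
      forall i a x, D x -> 'D_('e_i) (y a) x = \sum_b A i a b x * y b x].
Proof.
move=> oO Ox0 cA intA y0.
have [r [K [r0 rO S]]] := contract_small oO Ox0 cA intA.
have [y [yx0 [C C0 H]]] := small_total_system_solution S y0 r0.
pose D := ball x0 r.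
have DE x : D x -> `|x - x0| < r by rewrite /D -ball_normE /= distrC.
have dy a x : D x -> differentiable (y a) x /\
    forall i, 'D_('e_i) (y a) x = \sum_b A i a b x * y b x.
  move=> /DE xr; apply: (@quadratic_differentiable _ _ _ (r - `|x - x0|) C) => //.
    by rewrite subr_gt0.
  move=> h hr; have xhr : `|x + h - x0| < r.
    by rewrite addrAC; apply: le_lt_trans (ler_normD _ _) _; rewrite -ltrBrDl.
  have := H x h a xr xhr.
  rewrite (_ : \sum_b contract A h a b x * y b x =
    \sum_i h 0 i * \sum_b A i a b x * y b x) //.
  under eq_bigr do rewrite /contract mulr_suml.
  rewrite exchange_big /=; apply: eq_bigr => i _.
  by rewrite mulr_sumr; apply: eq_bigr => b _; rewrite mulrA.
have oD : open D by exact: ball_open.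
have DO : D `<=` O by move=> x /DE; exact: rO.
exists D, y; split => //.
- exact: ballxx.
- apply: (@total_system_smooth A) => //.
  + by move=> i a b k; apply: Ck_sub (cA i a b k).
  + by move=> a x Dx; exact: (dy a x Dx).1.
  + by move=> i a x Dx; exact: (dy a x Dx).2.
- by split => // i a x Dx; exact: (dy a x Dx).2.
Qed.

End Frobenius.

(** * Plateau functions *)

Section Plateau.
Context {R : realType}.
Implicit Types (s t : R) (k m : nat).

(** Differentiating t^-m exp(-1/t) stays in this family, which gives smoothness
    for all members at once. *)
Definition flat_exp m t : R := if 0 < t then t^-1 ^+ m * expR (- t^-1) else 0.

Lemma flat_exp_ge0 m t : 0 <= flat_exp m t.
Proof.
rewrite /flat_exp; case: ltP => // t0.
by rewrite mulr_ge0 ?expR_ge0 // exprn_ge0 // invr_ge0 ltW.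
Qed.

Lemma flat_exp_gt0 t : 0 < t -> 0 < flat_exp 0 t.
Proof. by move=> t0; rewrite /flat_exp t0 expr0 mul1r expR_gt0. Qed.

Lemma flat_exp_le0 m t : t <= 0 -> flat_exp m t = 0.
Proof. by rewrite /flat_exp; case: ltP. Qed.

(** exp x >= (1 + x / k) ^ k >= (x / k) ^ k, at x = 1 / t. *)
Lemma expRN_le k t : 0 < t -> expR (- t^-1) <= (k.+1%:R * t) ^+ k.+1.
Proof.
move=> t0; have kt : 0 < k.+1%:R * t by rewrite mulr_gt0.
rewrite expRN -[leRHS]invrK lef_pV2 ?posrE ?expR_gt0 ?invr_gt0 ?exprn_gt0 //.
rewrite -exprVn.
have -> : t^-1 = k.+1%:R * (k.+1%:R * t)^-1.
  by rewrite invfM mulrA mulfV ?mul1r.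
rewrite expRM_natl; apply: lerXn2r; rewrite ?nnegrE ?expR_ge0 //.
  by rewrite invr_ge0 ltW.
by apply: le_trans (expR_ge1Dx _); rewrite lerDr.
Qed.

Lemma flat_exp_quadratic m t : flat_exp m t <= m.+2%:R ^+ m.+2 * t ^+ 2.
Proof.
have [t0|t0] := leP t 0.
  by rewrite flat_exp_le0 // mulr_ge0 ?sqr_ge0 ?exprn_ge0.
rewrite /flat_exp t0.
apply: le_trans (ler_wpM2l _ (expRN_le m.+1 t0)) _.
  by rewrite exprn_ge0 // invr_ge0 ltW.
rewrite exprMn mulrCA.
have -> // : t^-1 ^+ m * t ^+ m.+2 = t ^+ 2.
by rewrite -addn2 exprD mulrA -exprMn mulVf ?gt_eqF // expr1n mul1r.
Qed.

Lemma flat_exp_derive m t : is_derive t 1 (flat_exp m)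
  (- m%:R * flat_exp m.+1 t + flat_exp m.+2 t).
Proof.
have [t0|t0|->] := ltgtP t 0.
- have n0 : \forall s \near t, flat_exp m s = cst 0 s.
    near=> s; rewrite flat_exp_le0 //; apply: ltW; near: s; exact: lt_nbhsl.
  rewrite !flat_exp_le0 ?ltW // mulr0 addr0.
  have : is_derive t 1 (cst 0 : R -> R) 0 by exact: is_derive_cst.
  by apply: near_eq_is_derive; apply: filterS n0 => s ->.
- have n0 : \forall s \near t, s^-1 ^+ m * expR (- s^-1) = flat_exp m s.
    near=> s; rewrite /flat_exp; case: ltP => // s0.
    have : 0 < s by near: s; exact: lt_nbhsr.
    by rewrite ltNge s0.
  have tn0 : t != 0 by rewrite gt_eqF.
  have Di : is_derive t 1 (fun s : R => s^-1) (- t^-1 ^+ 2).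
    have := @is_deriveV R id t 1 1 tn0 (is_derive_id t 1).
    by rewrite exprVn [_ *: _]mulr1.
  have De : is_derive t 1 (fun s => expR (- s^-1)) (t^-1 ^+ 2 * expR (- t^-1)).
    have DN : is_derive t 1 (fun s : R => - s^-1) (- (- t^-1 ^+ 2)).
      exact: is_deriveN.
    have := @is_derive1_comp R expR (fun s => - s^-1) t _ _ (is_derive_expR _) DN.
    by rewrite opprK mulrC.
  have Dm : is_derive t 1 (fun s : R => s^-1 ^+ m) (- m%:R * t^-1 ^+ m.+1).
    have := @is_deriveX R R (fun s : R => s^-1) m t 1 _ Di.
    have -> : (fun s : R => s^-1) ^+ m = (fun s => s^-1 ^+ m).
      by apply/funext => s; rewrite exprfctE.
    have E : m%:R * t^-1 ^+ m.-1 * - t^-1 ^+ 2 = - m%:R * t^-1 ^+ m.+1 :> R.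
      case: (m) => [|k]; first by rewrite !(mulr0n, mul0r, oppr0).
      by rewrite /= mulrN -mulrA -exprD addn2 mulNr.
    by move=> H; apply: is_derive_eq H E.
  apply: near_eq_is_derive n0 _.
  have := is_derive_mul Dm De.
  move=> H; apply: is_derive_eq H _; rewrite /flat_exp t0.
  rewrite [X in _ + X]mulrA -exprD addn2 mulrA.
  by [].
- have f0 k : flat_exp k 0 = 0 by rewrite flat_exp_le0.
  rewrite !f0 mulr0 addr0.
  have lin : linear (fun _ : R => 0 : R) by move=> a x y; rewrite scaler0 addr0.
  pose L : {linear R -> R} := HB.pack (fun _ : R => 0 : R)
    (GRing.isLinear.Build _ _ _ _ _ lin).
  have cL : continuous L by move=> x; exact: cvg_cst.
  have [df dE] : differentiable (flat_exp m) (0 : R) /\ 'd (flat_exp m) (0 : R) = L :> (R -> R).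
    apply: differentiable_of_estimate => // e e0.
    pose C : R := m.+2%:R ^+ m.+2; have C0 : 0 <= C by rewrite exprn_ge0.
    apply/nbhs_ballP; exists (e / (C + 1)) => /=; first by rewrite divr_gt0 // ltr_wpDl.
    move=> h; rewrite -ball_normE /= sub0r normrN => he.
    rewrite addr0 f0 !subr0 ger0_norm ?flat_exp_ge0 //.
    apply: le_trans (flat_exp_quadratic _ _) _; rewrite -/C.
    rewrite -[h ^+ 2]real_normK ?num_real // expr2 mulrA ler_wpM2r //.
    move: he; rewrite ltr_pdivlMr ?ltr_wpDl // => he.
    apply: le_trans (ltW he); rewrite mulrC ler_wpM2l //; lra.
  by apply: DeriveDef; [exact: diff_derivable | rewrite deriveE // dE].
Unshelve. all: by end_near. Qed.

Lemma flat_exp_smooth m : Cinfty setT (flat_exp m).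
Proof.
move=> k; elim: k m => [|k IH] m.
  move=> t _; apply: differentiable_continuous; apply/derivable1_diffP.
  by have [] := flat_exp_derive m t.
have df t : differentiable (flat_exp m) t.
  by apply/derivable1_diffP; have [] := flat_exp_derive m t.
apply: (@CkS _ _ _ _ _ _ (fun v t => v * (- m%:R * flat_exp m.+1 t + flat_exp m.+2 t))).
- exact: openT.
- by move=> t _; exact: df.
- move=> v t _; rewrite deriveE // diff1E // derive1E.
  by have [_ ->] := flat_exp_derive m t.
- move=> v; have oT := @openT R; apply: Ck_mul => //; first exact: Ck_cst.
  by apply: Ck_add => //; apply: Ck_mul => //; exact: Ck_cst.
Qed.

Definition smooth_step t := flat_exp 0 t / (flat_exp 0 t + flat_exp 0 (1 - t)).

Lemma smooth_step_denom t : flat_exp 0 t + flat_exp 0 (1 - t) != 0.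
Proof.
rewrite gt_eqF //; have [t0|t0] := ltP 0 t.
  by rewrite ltr_wpDr ?flat_exp_ge0 // flat_exp_gt0.
by rewrite ltr_wpDl ?flat_exp_ge0 // flat_exp_gt0 //; lra.
Qed.

Lemma smooth_step0 t : t <= 0 -> smooth_step t = 0.
Proof. by move=> t0; rewrite /smooth_step flat_exp_le0 // mul0r. Qed.

Lemma smooth_step1 t : 1 <= t -> smooth_step t = 1.
Proof.
move=> t1; have := smooth_step_denom t; rewrite /smooth_step.
by rewrite (flat_exp_le0 0 (t := 1 - t)) ?subr_le0 // addr0 => /mulfV.
Qed.

Lemma Ck_id k (D : set R) : open D -> Ck k D (fun t : R => t).
Proof.
case: k => [|k] oD; first by move=> x _; exact: cvg_id.
apply: (@CkS _ _ _ _ _ _ (fun v _ => v)) => //.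
- by move=> v x _; exact: derive_id.
- by move=> v; exact: Ck_cst.
Qed.

Lemma smooth_step_smooth : Cinfty setT smooth_step.
Proof.
have oT := @openT R.
move=> k; have s0 := @flat_exp_smooth 0 k.
have s1 : Ck k setT (fun t : R => flat_exp 0 (1 - t)).
  apply: (@Ck_compR _ _ _ _ setT (fun t => 1 - t)) => //.
  apply: (@Ck_eq _ _ R _ _ _ (fun t => 1 + (- 1) * t)) => //.
    by move=> t _; rewrite mulN1r.
  apply: Ck_add => //; first exact: Ck_cst.
  by apply: Ck_mul => //; [exact: Ck_cst | exact: Ck_id].
apply: Ck_mul => //; apply: Ck_inv => //.
  by move=> t _; exact: smooth_step_denom.
exact: Ck_add.
Qed.

Lemma Ck_prod (V : normedModType R) k (D : set V) (I : Type) (r : seq I)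
    (f : I -> V -> R) : open D -> (forall i, Ck k D (f i)) ->
  Ck k D (fun x => \prod_(i <- r) f i x).
Proof.
move=> oD cf; elim: r => [|i r IH].
  by apply: (@Ck_eq _ _ _ _ _ _ (fun=> 1 : R)) => // [x _|]; rewrite ?big_nil//; exact: Ck_cst.
apply: (@Ck_eq _ _ R _ _ _ (fun x => f i x * \prod_(i <- r) f i x)) => //.
  by move=> x _; rewrite big_cons.
exact: Ck_mul.
Qed.

Lemma Ck_idrV n k (D : set 'rV[R]_n) : open D -> Ck k D (fun x => x).
Proof.
case: k => [|k] oD; first by move=> x _; exact: cvg_id.
apply: (@CkS _ _ _ _ _ _ (fun v _ => v)) => //.
- by move=> v x _; exact: derive_id.
- by move=> v; exact: Ck_cst.
Qed.

Lemma plateau n (x0 : 'rV[R]_n) (r : R) : 0 < r -> exists chi : 'rV[R]_n -> R,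
  [/\ Cinfty setT chi, forall x, `|x - x0| <= r -> chi x = 1 &
      forall x, 2 * r <= `|x - x0| -> chi x = 0].
Proof.
move=> r0; have oT := @openT 'rV[R]_n.
(* The argument of the step is at least 1 when |x_i - x0_i| <= r, and negative
   when |x_i - x0_i| >= 2 r. *)
exists (fun x => \prod_i smooth_step (2 - ((x - x0) 0 i / r) ^+ 2)); split.
- move=> k; apply: Ck_prod => // i.
  apply: (@Ck_compR _ _ _ _ setT (fun x => 2 - ((x - x0) 0 i / r) ^+ 2)) => //;
    [exact: openT | | exact: smooth_step_smooth].
  have c1 : Ck k setT (fun x : 'rV[R]_n => (x - x0) 0 i / r).
    apply: Ck_mul => //; last exact: Ck_cst.
    apply: Ck_coord => //; apply: Ck_add => //; last exact: Ck_cst.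
    exact: Ck_idrV.
  apply: (@Ck_eq _ _ R _ _ _ (fun x => 2 + (- 1) * (((x - x0) 0 i / r) * ((x - x0) 0 i / r)))) => //.
    by move=> x _; rewrite mulN1r expr2.
  apply: Ck_add => //; first exact: Ck_cst.
  by do !apply: Ck_mul => //; exact: Ck_cst.
- move=> x xr; rewrite big1 // => i _; rewrite smooth_step1 //.
  have : ((x - x0) 0 i / r) ^+ 2 <= 1.
    rewrite -real_normK ?num_real // -[leRHS](expr1n _ 2) lerXn2r ?nnegrE //.
    rewrite normrM normfV (gtr0_norm r0) ler_pdivrMr // mul1r.
    exact: le_trans (ler_norm_coord _ _) xr.
  lra.
- move=> x xr.
  have /mx_norm_neq0[[u i] /= E] : `|x - x0| != 0.
    by rewrite gt_eqF // (lt_le_trans _ xr) // mulr_gt0.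
  rewrite (bigD1 i) //= smooth_step0 ?mul0r //.
  have : 2 ^+ 2 <= ((x - x0) 0 i / r) ^+ 2.
    rewrite -[leRHS]real_normK ?num_real // lerXn2r ?nnegrE //.
    rewrite normrM normfV (gtr0_norm r0) ler_pdivlMr //.
    by rewrite (ord1 u) in E; rewrite -E.
  rewrite expr2; lra.
Qed.

End Plateau.

(** * Smooth functions and tangent vectors on a manifold *)

Section Manifold.
Context {R : realType} {n : nat} {M : topologicalType} {A : set (chart R M n)}.
Hypothesis hM : smooth_manifold A.
Implicit Types (c d : chart R M n) (U W : set M) (p q : M) (f g : M -> R).
Implicit Types (v u : tvec R M) (w : 'rV[R]_n) (X Y Z : vfield R M).
Local Notation smooth_on := (smooth_on A).
Local Notation smooth_at := (smooth_at A).
Local Notation tangent := (tangent A).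
Local Notation smooth_vfield := (smooth_vfield A).
Local Notation "'e_ i" := (delta_mx 0 i : 'rV[R]_n) (at level 8, i at level 2).

Let img c W := c @` (chart_dom c `&` W).

Let img_chart_inv c W x : img c W x ->
  [/\ chart_dom c (chart_inv c x), W (chart_inv c x) & c (chart_inv c x) = x].
Proof. by move=> [p [cp Wp] <-]; rewrite chart_mapK. Qed.

Lemma chart_image_open c W : open W -> open (c @` (chart_dom c `&` W)).
Proof.
move=> oW; rewrite openE => x cx; have [dx Wx Ex] := img_chart_inv cx.
have ix : (c @` chart_dom c) x by exists (chart_inv c x).
have n1 : nbhs x (c @` chart_dom c).
  by apply: open_nbhs_nbhs; split => //; exact: chart_img_open.
have n2 : nbhs x (chart_inv c @^-1` W).
  by apply: (chart_inv_cont ix); exact: open_nbhs_nbhs.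
apply: filterS (filterI n1 n2) => y [[p cp <-]] /=.
by rewrite chart_mapK // => Wp; exists p.
Qed.

Let oimg c W : open W -> open (img c W). Proof. exact: chart_image_open. Qed.

Lemma smooth_on_sub U W f : W `<=` U -> smooth_on U f -> smooth_on W f.
Proof.
move=> WU sf c Ac k; apply: Ck_sub (sf c Ac k).
by move=> _ [p [cp Wp] <-]; exists p => //; split => //; exact: WU.
Qed.

Lemma smooth_on_local W f :
  (forall p, W p -> exists U g, [/\ open U, U p, (forall q, U q -> f q = g q) &
    smooth_on U g]) -> smooth_on W f.
Proof.
move=> H c Ac k; apply: Ck_local => _ [p [cp Wp] <-].
have [U [g [oU Up fg sg]]] := H _ Wp.
exists (img c U), (g \o chart_inv c); split.
- exact: oimg.
- by exists p.
- by move=> x /img_chart_inv[_ Ux _]; exact: fg.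
- exact: sg.
Qed.

Lemma smooth_on_eq W f g : open W -> (forall p, W p -> f p = g p) ->
  smooth_on W g -> smooth_on W f.
Proof. by move=> oW fg sg; apply: smooth_on_local => p Wp; exists W, g. Qed.

Lemma smooth_on_chart c W f : A c -> open W -> W `<=` chart_dom c ->
  Cinfty (c @` W) (f \o chart_inv c) -> smooth_on W f.
Proof.
move=> Ac oW Wc sf d Ad k.
have WE : img c W = c @` W.
  by rewrite /img setIidr.
have oc : open (chart_dom c) by exact: chart_dom_open.
apply: (@Ck_eq _ _ R _ _ _ ((f \o chart_inv c) \o (c \o chart_inv d))).
- exact: oimg.
- by move=> x /img_chart_inv[_ Wx _] /=; rewrite chart_mapK //; exact: Wc.
- apply: (@Ck_comp _ _ _ _ _ (c @` W)).
  + exact: oimg.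
  + by rewrite -WE; exact: oimg.
  + by move=> x /img_chart_inv[_ Wx _]; exists (chart_inv d x).
  + apply: Ck_sub (manifold_compat hM Ad Ac k).
    by move=> _ [p [dp Wp] <-]; exists p => //; split => //; exact: Wc.
  + exact: sf.
Qed.

Lemma smooth_on_cst W (a : R) : open W -> smooth_on W (fun=> a).
Proof. by move=> oW c Ac k; apply: Ck_cst; exact: oimg. Qed.

Lemma smooth_on_add W f g : open W -> smooth_on W f -> smooth_on W g ->
  smooth_on W (fun p => f p + g p).
Proof.
by move=> oW sf sg c Ac k; apply: Ck_add; [exact: oimg|exact: sf|exact: sg].
Qed.

Lemma smooth_on_mul W f g : open W -> smooth_on W f -> smooth_on W g ->
  smooth_on W (fun p => f p * g p).
Proof.
by move=> oW sf sg c Ac k; apply: Ck_mul; [exact: oimg|exact: sf|exact: sg].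
Qed.

Lemma smooth_on_comp W (E : set R) f (h : R -> R) : open W -> open E ->
  (forall p, W p -> E (f p)) -> smooth_on W f -> Cinfty E h ->
  smooth_on W (h \o f).
Proof.
move=> oW oE WE sf sh c Ac k.
apply: (@Ck_compR _ _ _ _ E (f \o chart_inv c)) => //.
- exact: oimg.
- by move=> x /img_chart_inv[_ Wx _]; exact: WE.
- exact: sf.
Qed.

Lemma smooth_on_coord c i : A c -> smooth_on (chart_dom c) (fun p => c p 0 i).
Proof.
move=> Ac; apply: (smooth_on_chart Ac) => //; first exact: chart_dom_open.
have oc : open (c @` chart_dom c) by exact: chart_img_open.
move=> k; apply: (@Ck_eq _ _ R _ _ _ (fun x : 'rV[R]_n => x 0 i)) => //.
  by move=> _ [p cp <-] /=; rewrite chart_mapK.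
by apply: Ck_coord => //; exact: Ck_idrV.
Qed.

Lemma smooth_on_at W f p : open W -> W p -> smooth_on W f -> smooth_at p f.
Proof. by move=> oW Wp sf; exists W. Qed.

Lemma smooth_at_eq W f g p : open W -> W p -> (forall q, W q -> f q = g q) ->
  smooth_at p f -> smooth_at p g.
Proof.
move=> oW Wp fg [U [oU Up sf]]; exists (U `&` W); split => //; first exact: openI.
apply: (@smooth_on_eq _ _ f); [exact: openI | by move=> q [_ /fg] | ].
by apply: smooth_on_sub sf => q [].
Qed.

Lemma smooth_at_coord c i p : A c -> chart_dom c p ->
  smooth_at p (fun p => c p 0 i).
Proof.
move=> Ac cp; apply: (@smooth_on_at (chart_dom c)) => //.
  exact: chart_dom_open.
exact: smooth_on_coord.
Qed.

Lemma smooth_at2 p f g : smooth_at p f -> smooth_at p g ->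
  exists W, [/\ open W, W p, smooth_on W f & smooth_on W g].
Proof.
move=> [U [oU Up sf]] [U' [oU' U'p sg]]; exists (U `&` U'); split => //.
- exact: openI.
- by apply: smooth_on_sub sf => q [].
- by apply: smooth_on_sub sg => q [].
Qed.

Lemma smooth_at_differentiable c p f : A c -> chart_dom c p -> smooth_at p f ->
  differentiable (f \o chart_inv c) (c p).
Proof.
move=> Ac cp [W [oW Wp sf]]; apply: (Ck_differentiable (sf c Ac 1%N)).
by exists p.
Qed.

(** The value 0 on functions that are not smooth at [p] makes this operator the
    only tangent vector with components [w]. *)
Definition chart_vec c p w : tvec R M := fun f =>
  if `[< smooth_at p f >] then 'D_w (f \o chart_inv c) (c p) else 0.

Lemma chart_vecE c p w f : smooth_at p f ->
  chart_vec c p w f = 'D_w (f \o chart_inv c) (c p).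
Proof. by move=> sf; rewrite /chart_vec asboolT. Qed.

Lemma chart_vec_nsmooth c p w f : ~ smooth_at p f -> chart_vec c p w f = 0.
Proof. by move=> sf; rewrite /chart_vec asboolF. Qed.

Lemma chart_vec_tangent c p w : A c -> chart_dom c p -> tangent p (chart_vec c p w).
Proof.
move=> Ac cp; split; last by move=> f; exact: chart_vec_nsmooth.
by exists c; split => //; exists w => f; exact: chart_vecE.
Qed.

Lemma near_chart c p W (P : 'rV[R]_n -> Prop) : chart_dom c p -> open W -> W p ->
  (forall q, chart_dom c q -> W q -> P (c q)) -> \forall x \near c p, P x.
Proof.
move=> cp oW Wp H; apply: (near_open (D := img c W)); first exact: oimg.
  by exists p.
by move=> _ [q [cq Wq] <-]; exact: H.
Qed.

(** Change of chart: the components in [c] are obtained by differentiating the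
    transition map. *)
Lemma tangent_chart_vec c p v : A c -> chart_dom c p -> tangent p v ->
  exists w, v = chart_vec c p w.
Proof.
move=> Ac cp [[d [Ad dp [w vE]]] v0].
exists ('D_w (c \o chart_inv d) (d p)); apply/funext => f.
have [sf|nf] := pselect (smooth_at p f); last first.
  by rewrite v0 // chart_vec_nsmooth.
rewrite vE // chart_vecE //.
have -> : 'D_w (f \o chart_inv d) (d p) =
    'D_w ((f \o chart_inv c) \o (c \o chart_inv d)) (d p).
  apply: near_eq_derive; apply: (near_chart dp (chart_dom_open c) cp) => q dq cq /=.
  by rewrite !chart_mapK.
have E : (c \o chart_inv d) (d p) = c p by rewrite /= chart_mapK.
have dc : differentiable (c \o chart_inv d) (d p).
  by apply: (Ck_differentiable (manifold_compat hM Ad Ac 1%N)); exists p.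
have df : differentiable (f \o chart_inv c) (c p) by exact: smooth_at_differentiable.
rewrite derive_comp_rV ?E // [RHS]derive_sum_coord //.
Qed.

Lemma tangentP p v : tangent p v -> exists c w,
  [/\ A c, chart_dom c p & v = chart_vec c p w].
Proof.
move=> tv; have [[c [Ac cp _]] _] := tv.
by have [w ->] := tangent_chart_vec Ac cp tv; exists c, w.
Qed.

Lemma chart_vec_coord c p w i : A c -> chart_dom c p ->
  chart_vec c p w (fun q => c q 0 i) = w 0 i.
Proof.
move=> Ac cp; rewrite chart_vecE; last exact: smooth_at_coord.
have -> : 'D_w ((fun q => c q 0 i) \o chart_inv c) (c p) =
    'D_w (fun x : 'rV[R]_n => x 0 i) (c p).
  apply: near_eq_derive; apply: (near_chart cp (chart_dom_open c) cp) => q cq _ /=.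
  by rewrite chart_mapK.
by rewrite (derive_coord (f := id)) // derive_id.
Qed.

Lemma chart_vec_lin c p (a : R) w w' : A c -> chart_dom c p ->
  chart_vec c p (a *: w + w') = a *: chart_vec c p w + chart_vec c p w'.
Proof.
move=> Ac cp; apply/funext => f.
transitivity (a * chart_vec c p w f + chart_vec c p w' f); last by [].
have [sf|nf] := pselect (smooth_at p f); last first.
  by rewrite !chart_vec_nsmooth // mulr0 addr0.
have df := smooth_at_differentiable Ac cp sf.
by rewrite !chart_vecE // !(deriveE _ df) linearP.
Qed.

Lemma chart_vec_sum c p w : A c -> chart_dom c p ->
  chart_vec c p w = \sum_i w 0 i *: chart_vec c p ('e_ i).
Proof.
move=> Ac cp.
have V0 : chart_vec c p 0 = 0.
  have := chart_vec_lin 1 0 0 Ac cp; rewrite scaler0 addr0 scale1r => /eqP.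
  by rewrite -subr_eq0 opprD addNKr oppr_eq0 => /eqP.
rewrite [in LHS](row_sum_delta w).
elim/big_ind2 : _ => //.
  move=> v1 w1 v2 w2 <- <-.
  by have := chart_vec_lin 1 w1 w2 Ac cp; rewrite !scale1r.
move=> i _; have := chart_vec_lin (w 0 i) ('e_ i) 0 Ac cp.
by rewrite V0 !addr0.
Qed.

Lemma tangent_ext c p v u : A c -> chart_dom c p -> tangent p v -> tangent p u ->
  (forall i, v (fun q => c q 0 i) = u (fun q => c q 0 i)) -> v = u.
Proof.
move=> Ac cp /(tangent_chart_vec Ac cp)[w ->] /(tangent_chart_vec Ac cp)[w' ->] H.
suff -> : w = w' by [].
by apply/rowP => i; have := H i; rewrite !chart_vec_coord.
Qed.

Lemma tangent_lin p (a : R) v u : tangent p v -> tangent p u ->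
  tangent p (a *: v + u).
Proof.
move=> tv tu; have [c [w [Ac cp ->]]] := tangentP tv.
have [w' ->] := tangent_chart_vec Ac cp tu.
by rewrite -chart_vec_lin //; exact: chart_vec_tangent.
Qed.

Lemma tangent0 p : tangent p 0.
Proof.
have [c Ac cp] := manifold_cover hM p.
have := chart_vec_tangent 0 Ac cp => t0.
by have := tangent_lin (-1) t0 t0; rewrite scaleN1r addNr.
Qed.

Lemma tangentD p v u : tangent p v -> tangent p u -> tangent p (v + u).
Proof. by move=> tv tu; have := tangent_lin 1 tv tu; rewrite scale1r. Qed.

Lemma tangentZ p (a : R) v : tangent p v -> tangent p (a *: v).
Proof. by move=> tv; have := tangent_lin a tv (tangent0 p); rewrite addr0. Qed.

Lemma tangent_sum_chart c p v : A c -> chart_dom c p -> tangent p v ->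
  v = \sum_i v (fun q => c q 0 i) *: chart_vec c p ('e_ i).
Proof.
move=> Ac cp /(tangent_chart_vec Ac cp)[w ->].
rewrite [LHS]chart_vec_sum //; apply: eq_bigr => i _.
by rewrite chart_vec_coord.
Qed.

Section Derivation.
Variables (p : M) (v : tvec R M).
Hypothesis tv : tangent p v.

Lemma tangent_local W f g : open W -> W p -> (forall q, W q -> f q = g q) ->
  v f = v g.
Proof.
move=> oW Wp fg; have [c [w [Ac cp ->]]] := tangentP tv.
have [sf|nf] := pselect (smooth_at p f).
  have sg := smooth_at_eq oW Wp fg sf.
  rewrite !chart_vecE //; apply: near_eq_derive.
  by apply: (near_chart cp oW Wp) => q cq Wq /=; rewrite chart_mapK // fg.
rewrite !chart_vec_nsmooth // => sg; apply: nf.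
by apply: smooth_at_eq sg => [||q Wq]; [exact: oW|exact: Wp|rewrite fg].
Qed.

Lemma tangent_cst (a : R) : v (fun=> a) = 0.
Proof.
have [c [w [Ac cp ->]]] := tangentP tv.
rewrite chart_vecE; first exact: derive_cst.
by apply: (@smooth_on_at setT) => //; [exact: openT | apply: smooth_on_cst; exact: openT].
Qed.

Lemma tangent_addf f g : smooth_at p f -> smooth_at p g ->
  v (fun q => f q + g q) = v f + v g.
Proof.
move=> sf sg; have [c [w [Ac cp ->]]] := tangentP tv.
have [W [oW Wp sfW sgW]] := smooth_at2 sf sg.
rewrite !chart_vecE //; last first.
  by apply: (smooth_on_at oW Wp); exact: smooth_on_add.
rewrite -deriveD //; apply: diff_derivable; exact: smooth_at_differentiable.
Qed.

Lemma tangent_mulf f g : smooth_at p f -> smooth_at p g ->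
  v (fun q => f q * g q) = v f * g p + f p * v g.
Proof.
move=> sf sg; have [c [w [Ac cp ->]]] := tangentP tv.
have [W [oW Wp sfW sgW]] := smooth_at2 sf sg.
rewrite !chart_vecE //; last first.
  by apply: (smooth_on_at oW Wp); exact: smooth_on_mul.
have df := smooth_at_differentiable Ac cp sf.
have dg := smooth_at_differentiable Ac cp sg.
have := deriveM (diff_derivable (v := w) df) (diff_derivable (v := w) dg).
have ffE : (f \o chart_inv c) (c p) = f p by rewrite /= chart_mapK.
have gE : (g \o chart_inv c) (c p) = g p by rewrite /= chart_mapK.
by rewrite ffE gE => E; rewrite [LHS]E addrC; congr (_ + _); exact: mulrC.
Qed.

Lemma tangent_compf f (h : R -> R) (dh : R) : smooth_at p f ->
  smooth_at p (h \o f) -> is_derive (f p) 1 h dh -> v (h \o f) = dh * v f.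
Proof.
move=> sf shf dhP; have [c [w [Ac cp ->]]] := tangentP tv.
rewrite !chart_vecE //.
have df := smooth_at_differentiable Ac cp sf.
have E : (f \o chart_inv c) (c p) = f p by rewrite /= chart_mapK.
rewrite (derive_compR (f := f \o chart_inv c)) //; last first.
  by rewrite E; apply/derivable1_diffP; case: dhP.
by rewrite E mulrC; case: dhP => _ ->.
Qed.

End Derivation.

(** * Smooth vector fields *)

Lemma smooth_vfield_sub U W X : W `<=` U -> smooth_vfield U X -> smooth_vfield W X.
Proof.
move=> WU [tX sX]; split => [p /WU|V f oV VW]; first exact: tX.
by apply: sX => //; exact: subset_trans WU.
Qed.

Lemma smooth_vfield_local W X :
  (forall p, W p -> exists U Y, [/\ open U, U p, (forall q, U q -> X q = Y q) &
    smooth_vfield U Y]) -> smooth_vfield W X.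
Proof.
move=> H; split.
  by move=> p /H[U [Y [oU Up XY [tY _]]]]; rewrite XY //; exact: tY.
move=> V f oV VW sf; apply: smooth_on_local => p Vp.
have [U [Y [oU Up XY [_ sY]]]] := H _ (VW _ Vp).
exists (U `&` V), (fun p => Y p f); split => //.
- exact: openI.
- by move=> q [/XY ->].
- apply: sY; [exact: openI | by move=> q [] |].
  by apply: smooth_on_sub sf => q [].
Qed.

Lemma smooth_vfield_eq W X Y : open W -> (forall p, W p -> X p = Y p) ->
  smooth_vfield W Y -> smooth_vfield W X.
Proof. by move=> oW XY sY; apply: smooth_vfield_local => p Wp; exists W, Y. Qed.

Lemma smooth_vfield_vadd W X Y : smooth_vfield W X -> smooth_vfield W Y ->
  smooth_vfield W (vadd X Y).
Proof.
move=> [tX sX] [tY sY]; split.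
  by move=> p Wp; apply: tangentD; [exact: tX | exact: tY].
by move=> V f oV VW sf; apply: smooth_on_add => //; [exact: sX | exact: sY].
Qed.

Lemma smooth_vfield_vscale W f X : smooth_on W f -> smooth_vfield W X ->
  smooth_vfield W (vscale f X).
Proof.
move=> sf [tX sX]; split.
  by move=> p Wp; apply: tangentZ; exact: tX.
move=> V g oV VW sg; apply: smooth_on_mul => //; last exact: sX.
exact: smooth_on_sub sf.
Qed.

Lemma smooth_vfield_app W X f : open W -> smooth_vfield W X -> smooth_on W f ->
  smooth_on W (fun p => X p f).
Proof. by move=> oW [_ sX]; exact: sX. Qed.

Lemma smooth_vfield0 W : smooth_vfield W (fun=> 0).
Proof.
split; first by move=> p _; exact: tangent0.
by move=> V f oV _ _; exact: smooth_on_cst.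
Qed.

Definition partial c (i : 'I_n) : vfield R M := fun p => chart_vec c p ('e_ i).

Lemma smooth_partial c i : A c -> smooth_vfield (chart_dom c) (partial c i).
Proof.
move=> Ac; split; first by move=> p cp; exact: chart_vec_tangent.
move=> V f oV Vc sf.
have oc : open (c @` V) by rewrite -(setIidr Vc); exact: chart_image_open.
apply: (smooth_on_chart Ac oV Vc) => k.
apply: (@Ck_eq _ _ R _ _ _ ('D_('e_ i) (f \o chart_inv c))) => //.
  move=> _ [p Vp <-] /=; rewrite chart_mapK; last exact: Vc.
  by rewrite /partial chart_vecE //; exact: smooth_on_at sf.
by apply: Ck_derive; have := sf c Ac k.+1; rewrite setIidr.
Qed.

Lemma partialE c i p f : smooth_at p f ->
  partial c i p f = 'D_('e_ i) (f \o chart_inv c) (c p).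
Proof. exact: chart_vecE. Qed.

Lemma tangent_sum_partial c p v : A c -> chart_dom c p -> tangent p v ->
  v = \sum_i v (fun q => c q 0 i) *: partial c i p.
Proof. exact: tangent_sum_chart. Qed.

Lemma partial_coord c i j p : A c -> chart_dom c p ->
  partial c i p (fun q => c q 0 j) = (i == j)%:R.
Proof.
by move=> Ac cp; rewrite /partial chart_vec_coord // mxE eqxx eq_sym.
Qed.

(** A plateau function read in a chart extends by 0 to a smooth function on [M]:
    it vanishes off the preimage [K] of a closed ball, which is compact, hence
    closed because [M] is Hausdorff. *)
Lemma plateau_on_manifold W p : open W -> W p -> exists (chi : M -> R) V K,
  [/\ smooth_on setT chi, open V /\ V p, V `<=` W, (forall q, V q -> chi q = 1) &
   [/\ closed K, K `<=` W & forall q, ~ K q -> chi q = 0]].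
Proof.
move=> oW Wp; have [c Ac cp] := manifold_cover hM p.
have oE : open (img c W) by exact: oimg.
have : nbhs (c p) (img c W) by apply: open_nbhs_nbhs; split => //; exists p.
move=> /nbhs_ballP[r0 /= r00 r0W].
pose r := r0 / 3; have r_gt0 : 0 < r by rewrite divr_gt0.
have ballW x : `|x - c p| <= 2 * r -> img c W x.
  move=> xr; apply: r0W; rewrite -ball_normE /= distrC; apply: le_lt_trans xr _.
  by rewrite /r; lra.
have [chi0 [schi chi1 chi00]] := plateau (c p) r_gt0.
pose B := closed_ball_ Num.Def.normr (c p) (2 * r).
have BE x : B x -> `|x - c p| <= 2 * r by rewrite /B /closed_ball_ /= distrC.
pose K := chart_inv c @` B.
have cB : compact B.
  apply: bounded_closed_compact; last exact: closed_closed_ball_.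
  exists (`|c p| + 2 * r); split; first exact: num_real.
  move=> x xr y /BE yr; apply: le_trans (ltW xr).
  rewrite -(subrK (c p) y) addrC; apply: le_trans (ler_normD _ _) _.
  by rewrite lerD2l.
have cK : closed K.
  apply: (compact_closed (manifold_hausdorff hM)).
  apply: continuous_compact cB; apply: continuous_in_subspaceT => x.
  rewrite inE => /BE/ballW/img_chart_inv[dx _ Ex].
  by apply: chart_inv_cont; exists (chart_inv c x).
have KW : K `<=` W `&` chart_dom c.
  by move=> _ [x /BE/ballW/img_chart_inv[dx Wx _] <-].
pose chi q := if `[< chart_dom c q >] then chi0 (c q) else 0.
have chiK q : ~ K q -> chi q = 0.
  move=> nK; rewrite /chi; case: asboolP => // cq; apply: chi00.
  rewrite leNgt; apply/negP => /ltW cqr; apply: nK; exists (c q).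
    by rewrite /B /closed_ball_ /= distrC.
  by rewrite chart_mapK.
pose V := chart_dom c `&` (c @^-1` ball (c p) r).
have oc := chart_dom_open c.
have oV : open V.
  rewrite openE => q [cq Vq]; apply: filterI; first exact: open_nbhs_nbhs.
  apply: (chart_map_cont cq); apply: open_nbhs_nbhs; split => //; exact: ball_open.
have VE q : V q -> chart_dom c q /\ `|c q - c p| <= r.
  by move=> [cq]; rewrite /= -ball_normE /= distrC => /ltW.
exists chi, V, K; split.
- apply: smooth_on_local => q _.
  have [cq|ncq] := pselect (chart_dom c q); last first.
    exists (~` K), (fun=> 0); split => //.
    + exact: closed_openC.
    + by move=> /KW[].
    + by apply: smooth_on_cst; exact: closed_openC.
  exists (chart_dom c), (chi0 \o c); split => //.
    by move=> q' cq'; rewrite /chi asboolT.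
  apply: (smooth_on_chart Ac) => // k.
  apply: (@Ck_eq _ _ R _ _ _ chi0); first exact: chart_img_open.
    by move=> _ [q' cq' <-] /=; rewrite chart_mapK.
  exact: Ck_sub (schi k).
- by split => //; split => //=; exact: ballxx.
- move=> q /VE[cq qr]; have /ballW/img_chart_inv[_] : `|c q - c p| <= 2 * r by lra.
  by rewrite chart_mapK.
- by move=> q /VE[cq qr]; rewrite /chi asboolT // chi1.
- by split => // q /KW[].
Qed.

(** This is how hypotheses on global vector fields become available for vector
    fields on an open subset. *)
Lemma vfield_extension W p X : open W -> W p -> smooth_vfield W X ->
  exists X' V, [/\ smooth_vfield setT X', open V, V p, V `<=` W &
    forall q, V q -> X q = X' q].
Proof.
move=> oW Wp sX.
have [chi [V [K [schi [oV Vp] VW chi1 [cK KW chi0]]]]] := plateau_on_manifold oW Wp.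
exists (vscale chi X), V; split => //; last first.
  by move=> q Vq; rewrite /vscale chi1 // scale1r.
apply: smooth_vfield_local => q _.
have [Wq|nWq] := pselect (W q).
  exists W, (vscale chi X); split => //.
  by apply: smooth_vfield_vscale => //; exact: smooth_on_sub schi.
exists (~` K), (fun=> 0); split.
- exact: closed_openC.
- by move=> /KW.
- by move=> q' /chi0 E; rewrite /vscale E scale0r.
- exact: smooth_vfield0.
Qed.

End Manifold.

(** * Connections on open subsets *)

Section Connection.
Context {R : realType} {n : nat} {M : topologicalType} {A : set (chart R M n)}.
Hypothesis hM : smooth_manifold A.
Implicit Types (U V W : set M) (p q : M) (f : M -> R).
Implicit Types (u v w : tvec R M) (X Y Z : vfield R M).
Implicit Types (nabla : connection R M) (g : metric R M).
Local Notation smooth_on := (smooth_on A).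
Local Notation smooth_at := (smooth_at A).
Local Notation tangent := (tangent A).
Local Notation smooth_vfield := (smooth_vfield A).

(** Multiplying by the indicator function of [W], which is smooth on [W], turns
    equality on [W] into equality everywhere. *)
Lemma nabla_local U nabla W X X' Y Y' p : affine_connection A U nabla ->
  open W -> W `<=` U -> W p ->
  smooth_vfield W X -> smooth_vfield W X' ->
  smooth_vfield W Y -> smooth_vfield W Y' ->
  (forall q, W q -> X q = X' q) -> (forall q, W q -> Y q = Y' q) ->
  nabla X Y p = nabla X' Y' p.
Proof.
move=> cn oW WU Wp sX sX' sY sY' XX' YY'.
pose ind q : R := if `[< W q >] then 1 else 0.
have ind1 q : W q -> ind q = 1 by move=> Wq; rewrite /ind asboolT.
have sind : smooth_on W ind.
  by apply: (smooth_on_eq oW ind1); exact: smooth_on_cst.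
have scale_eq X1 X2 : (forall q, W q -> X1 q = X2 q) -> vscale ind X1 = vscale ind X2.
  move=> E; apply/funext => q; rewrite /vscale.
  have [Wq|nWq] := pselect (W q); first by rewrite E.
  by rewrite /ind asboolF // !scale0r.
have left X1 Z : smooth_vfield W X1 -> smooth_vfield W Z ->
    nabla (vscale ind X1) Z p = nabla X1 Z p.
  by move=> s1 sZ; rewrite (connection_scalel cn oW) // ind1 // scale1r.
have right X1 Z : smooth_vfield W X1 -> smooth_vfield W Z ->
    nabla X1 (vscale ind Z) p = nabla X1 Z p.
  move=> s1 sZ; rewrite (connection_leibniz cn oW) // ind1 // scale1r.
  have t1 : tangent p (X1 p) by case: s1 => + _; exact.
  by rewrite (tangent_local hM t1 oW Wp ind1) (tangent_cst hM t1) scale0r add0r.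
rewrite -(left X) // (scale_eq X X') // left //.
by rewrite -(right X') // (scale_eq Y Y') // right.
Qed.

Lemma bracket_local V X X' Y Y' p : open V -> V p ->
  tangent p (X p) -> tangent p (Y p) ->
  (forall q, V q -> X q = X' q) -> (forall q, V q -> Y q = Y' q) ->
  bracket A X Y p = bracket A X' Y' p.
Proof.
move=> oV Vp tX tY XX' YY'; apply/funext => f; rewrite /bracket.
case: asboolP => // _; rewrite -XX' // -YY' //; congr (_ - _).
  by apply: (tangent_local hM tX oV Vp) => q Vq; rewrite YY'.
by apply: (tangent_local hM tY oV Vp) => q Vq; rewrite XX'.
Qed.

(** For a torsion-free connection the bracket is a difference of covariant
    derivatives, so its smoothness does not require a computation in charts. *)
Lemma bracket_smooth U nabla X Y : affine_connection A U nabla -> open U ->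
  torsion_free A U nabla -> smooth_vfield U X -> smooth_vfield U Y ->
  smooth_vfield U (bracket A X Y).
Proof.
move=> cn oU tf sX sY.
have s1 := connection_smooth cn oU (@subset_refl _ U) sX sY.
have s2 := connection_smooth cn oU (@subset_refl _ U) sY sX.
apply: (smooth_vfield_eq oU (Y := vadd (nabla X Y) (vscale (fun=> -1) (nabla Y X)))).
  by move=> p Up; rewrite -tf // /vadd /vscale scaleN1r.
apply: smooth_vfield_vadd => //; apply: smooth_vfield_vscale => //.
exact: smooth_on_cst.
Qed.

Section Restriction.
Variables (g : metric R M) (nabla : connection R M).
Hypothesis hS : statistical_manifold A setT g nabla.

Let cn := stat_connection hS.

Let ext3 W X Y Z p : open W -> W p -> smooth_vfield W X -> smooth_vfield W Y ->
  smooth_vfield W Z -> exists X' Y' Z' V,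
  [/\ [/\ smooth_vfield setT X', smooth_vfield setT Y' & smooth_vfield setT Z'],
    open V, V p, V `<=` W &
    [/\ forall q, V q -> X q = X' q, forall q, V q -> Y q = Y' q &
        forall q, V q -> Z q = Z' q]].
Proof.
move=> oW Wp sX sY sZ.
have [X' [V1 [sX' oV1 V1p V1W E1]]] := vfield_extension hM oW Wp sX.
have [Y' [V2 [sY' oV2 V2p V2W E2]]] := vfield_extension hM oW Wp sY.
have [Z' [V3 [sZ' oV3 V3p V3W E3]]] := vfield_extension hM oW Wp sZ.
exists X', Y', Z', (V1 `&` V2 `&` V3); split => //.
- by apply: openI => //; exact: openI.
- by move=> q [[/V1W]].
- by split=> q [[]]; auto.
Qed.

Let to_sub V X : smooth_vfield setT X -> smooth_vfield V X.
Proof. exact: smooth_vfield_sub. Qed.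

Let nloc V X X' Y Y' p : open V -> V p ->
  smooth_vfield V X -> smooth_vfield V X' ->
  smooth_vfield V Y -> smooth_vfield V Y' ->
  (forall q, V q -> X q = X' q) -> (forall q, V q -> Y q = Y' q) ->
  nabla X Y p = nabla X' Y' p.
Proof. by move=> oV Vp; apply: (nabla_local cn). Qed.

Lemma torsion_free_restrict W : open W -> torsion_free A W nabla.
Proof.
move=> oW X Y sX sY p Wp.
have [X' [Y' [_ [V [[sX' sY' _] oV Vp VW [EX EY _]]]]]] := ext3 oW Wp sX sY sY.
have sXV := smooth_vfield_sub VW sX; have sYV := smooth_vfield_sub VW sY.
have sXV' := to_sub V sX'; have sYV' := to_sub V sY'.
rewrite (nloc oV Vp sXV sXV' sYV sYV') // (nloc oV Vp sYV sYV' sXV sXV') //.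
rewrite (stat_torsion_free hS) //; apply/esym; apply: (bracket_local oV) => //.
  by case: sX => + _; exact.
by case: sY => + _; exact.
Qed.

Lemma cov_metric_symmetric_restrict W : open W ->
  totally_symmetric A W (cov_metric g nabla).
Proof.
move=> oW X Y Z sX sY sZ p Wp.
have [X' [Y' [Z' [V [[sX' sY' sZ'] oV Vp VW [EX EY EZ]]]]]] := ext3 oW Wp sX sY sZ.
have loc X1 Y1 Z1 X1' Y1' Z1' : smooth_vfield V X1 -> smooth_vfield V X1' ->
    smooth_vfield V Y1 -> smooth_vfield V Y1' ->
    smooth_vfield V Z1 -> smooth_vfield V Z1' ->
    (forall q, V q -> X1 q = X1' q) -> (forall q, V q -> Y1 q = Y1' q) ->
    (forall q, V q -> Z1 q = Z1' q) ->
    cov_metric g nabla X1 Y1 Z1 p = cov_metric g nabla X1' Y1' Z1' p.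
  move=> s1 s1' s2 s2' s3 s3' e1 e2 e3; rewrite /cov_metric.
  rewrite (nloc oV Vp s1 s1' s2 s2') // (nloc oV Vp s1 s1' s3 s3') //.
  rewrite -e1 // -e2 // -e3 //; congr (_ - _ - _).
  apply: (tangent_local hM _ oV Vp); first by case: s1 => + _; exact.
  by move=> q Vq; rewrite e2 // e3.
have sXV := smooth_vfield_sub VW sX; have sYV := smooth_vfield_sub VW sY.
have sZV := smooth_vfield_sub VW sZ.
have sXV' := to_sub V sX'; have sYV' := to_sub V sY'; have sZV' := to_sub V sZ'.
rewrite (loc X Y Z X' Y' Z') // (loc Y X Z Y' X' Z') // (loc X Z Y X' Z' Y') //.
exact: (stat_symmetric hS).
Qed.

Lemma constant_curvature_restrict (K : R) W :
  (forall X Y Z, smooth_vfield setT X -> smooth_vfield setT Y ->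
   smooth_vfield setT Z -> forall p, setT p ->
   curvature A nabla X Y Z p = K *: (g p (Y p) (Z p) *: X p - g p (X p) (Z p) *: Y p)) ->
  open W -> forall X Y Z, smooth_vfield W X -> smooth_vfield W Y ->
  smooth_vfield W Z -> forall p, W p ->
  curvature A nabla X Y Z p = K *: (g p (Y p) (Z p) *: X p - g p (X p) (Z p) *: Y p).
Proof.
move=> HK oW X Y Z sX sY sZ p Wp.
have [X' [Y' [Z' [V [[sX' sY' sZ'] oV Vp VW [EX EY EZ]]]]]] := ext3 oW Wp sX sY sZ.
have sXV := smooth_vfield_sub VW sX; have sYV := smooth_vfield_sub VW sY.
have sZV := smooth_vfield_sub VW sZ.
have sXV' := to_sub V sX'; have sYV' := to_sub V sY'; have sZV' := to_sub V sZ'.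
have sn X1 Y1 : smooth_vfield V X1 -> smooth_vfield V Y1 -> smooth_vfield V (nabla X1 Y1).
  by apply: (connection_smooth cn).
have tfV := torsion_free_restrict oV.
have sb X1 Y1 : smooth_vfield V X1 -> smooth_vfield V Y1 ->
    smooth_vfield V (bracket A X1 Y1).
  apply: (bracket_smooth (U := V) (nabla := nabla)) => //.
  by split=> W1 *; [apply: (connection_smooth cn)|apply: (connection_addl cn (W := W1))
    |apply: (connection_scalel cn (W := W1))|apply: (connection_addr cn (W := W1))
    |apply: (connection_leibniz cn (W := W1))].
have -> : curvature A nabla X Y Z p = curvature A nabla X' Y' Z' p.
  rewrite /curvature; congr (_ - _ - _).
  - apply: (nloc oV Vp) => //; try exact: sn.
    by move=> q Vq; exact: (nloc oV Vq).
  - apply: (nloc oV Vp) => //; try exact: sn.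
    by move=> q Vq; exact: (nloc oV Vq).
  - apply: (nloc oV Vp) => //; try exact: sb.
    move=> q Vq; apply: (bracket_local oV) => //.
      by case: sXV => + _; exact.
    by case: sYV => + _; exact.
by rewrite HK // -EX // -EY // -EZ.
Qed.

Lemma statistical_manifold_restrict W : open W -> statistical_manifold A W g nabla.
Proof.
move=> oW; split.
- have m := stat_metric hS; split.
  + by move=> p _ a u v w; exact: (metric_linear m).
  + by move=> p _ u v; exact: (Defs.metric_sym m).
  + by move=> p _ u; exact: (metric_pos m).
  + by move=> V X Y oV _; exact: (metric_smooth m).
- by split=> W1 *; [apply: (connection_smooth cn)|apply: (connection_addl cn (W := W1))
    |apply: (connection_scalel cn (W := W1))|apply: (connection_addr cn (W := W1))
    |apply: (connection_leibniz cn (W := W1))].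
- exact: torsion_free_restrict.
- exact: cov_metric_symmetric_restrict.
Qed.

End Restriction.

(** * Flatness after a projective change *)

Lemma expR_smooth : Cinfty setT (@expR R).
Proof.
have oT := @openT R.
move=> k; elim: k => [|k IH]; first by move=> t _; exact: continuous_expR.
have df t : differentiable (@expR R) t.
  by apply/derivable1_diffP; exact: derivable_expR.
apply: (@CkS R R R k setT expR (fun v t : R => v * expR t)) => //.
- move=> v t _; rewrite deriveE // diff1E // derive1E.
  by have [_ ->] := is_derive_expR t.
- by move=> v; apply: Ck_mul => //; exact: Ck_cst.
Qed.

Lemma scale_realE (a b : R) : a *: b = a * b.
Proof. by []. Qed.

Section ProjectiveChange.
Variables (g : metric R M) (nabla : connection R M) (U : set M) (phi : M -> R).
Hypothesis hS : statistical_manifold A U g nabla.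
Hypothesis oU : open U.
Hypothesis sphi : smooth_on U phi.

Definition proj_metric : metric R M := fun p v w => expR (phi p) * g p v w.

Definition proj_nabla : connection R M := fun X Y =>
  vadd (vadd (nabla X Y) (vscale (fun p => X p phi) Y)) (vscale (fun p => Y p phi) X).

Let cn := stat_connection hS.
Let me := stat_metric hS.

Let sphiW W : W `<=` U -> smooth_on W phi.
Proof. by move=> WU; exact: smooth_on_sub sphi. Qed.

Let sapp W X : open W -> W `<=` U -> smooth_vfield W X ->
  smooth_on W (fun p => X p phi).
Proof. by move=> oW WU sX; apply: smooth_vfield_app => //; exact: sphiW. Qed.

Let vf_tangent W X p : smooth_vfield W X -> W p -> tangent p (X p).
Proof. by case=> + _; exact. Qed.

Let sexp : smooth_on U (expR \o phi).
Proof. by apply: (smooth_on_comp (E := setT)) => //; [exact: openT|exact: expR_smooth]. Qed.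

Lemma proj_nablaE X Y p :
  proj_nabla X Y p = nabla X Y p + X p phi *: Y p + Y p phi *: X p.
Proof. by []. Qed.

Lemma proj_nabla_affine : affine_connection A U proj_nabla.
Proof.
split.
- move=> W X Y oW WU sX sY.
  have sn := connection_smooth cn oW WU sX sY.
  by do !apply: smooth_vfield_vadd => //; apply: smooth_vfield_vscale => //; exact: sapp.
- move=> W X X' Y oW WU sX sX' sY p Wp.
  rewrite !proj_nablaE (connection_addl cn oW) //.
  apply/funext => f; rewrite /vadd !(fctE, scale_realE); ring.
- move=> W f X Y oW WU sf sX sY p Wp.
  rewrite !proj_nablaE (connection_scalel cn oW) //.
  by apply/funext => h; rewrite /vscale !(fctE, scale_realE); ring.
- move=> W X Y Y' oW WU sX sY sY' p Wp.
  rewrite !proj_nablaE (connection_addr cn oW) //.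
  by apply/funext => f; rewrite /vadd !(fctE, scale_realE); ring.
- move=> W f X Y oW WU sf sX sY p Wp.
  rewrite !proj_nablaE (connection_leibniz cn oW) //.
  by apply/funext => h; rewrite /vscale !(fctE, scale_realE); ring.
Qed.

Lemma metric_linearr p a u v w : U p -> tangent p u -> tangent p v -> tangent p w ->
  g p w (a *: u + v) = a * g p w u + g p w v.
Proof.
move=> Up tu tv tw; rewrite (Defs.metric_sym me) //; last exact: tangent_lin.
by rewrite (metric_linear me) // (Defs.metric_sym me Up tu) // (Defs.metric_sym me Up tv).
Qed.

(** Up to the factor exp(phi), the cubic form nabla g changes by
    - dphi(X) g(Y,Z) - dphi(Y) g(X,Z) - dphi(Z) g(X,Y), which is totally
    symmetric. *)
Lemma proj_statistical : statistical_manifold A U proj_metric proj_nabla.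
Proof.
split.
- split.
  + move=> p Up a u v w tu tv tw; rewrite /proj_metric (metric_linear me) //; ring.
  + by move=> p Up u v tu tv; rewrite /proj_metric (Defs.metric_sym me).
  + by move=> p Up u tu u0; rewrite mulr_gt0 ?expR_gt0 // (metric_pos me).
  + move=> W X Y oW WU sX sY; apply: smooth_on_mul => //.
      exact: smooth_on_sub sexp.
    exact: (metric_smooth me).
- exact: proj_nabla_affine.
- move=> X Y sX sY p Up; rewrite -(stat_torsion_free hS) // !proj_nablaE.
  by apply/funext => f; rewrite !(fctE, scale_realE); ring.
- have UU := @subset_refl _ U.
  have E X Y Z p : smooth_vfield U X -> smooth_vfield U Y -> smooth_vfield U Z -> U p ->
     cov_metric proj_metric proj_nabla X Y Z p = expR (phi p) *
      (cov_metric g nabla X Y Z p - X p phi * g p (Y p) (Z p)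
       - Y p phi * g p (X p) (Z p) - Z p phi * g p (X p) (Y p)).
    move=> sX sY sZ Up.
    have tX := vf_tangent sX Up; have tY := vf_tangent sY Up; have tZ := vf_tangent sZ Up.
    have tXY := vf_tangent (connection_smooth cn oU UU sX sY) Up.
    have tXZ := vf_tangent (connection_smooth cn oU UU sX sZ) Up.
    rewrite /cov_metric /proj_metric.
    have -> : X p (fun q => expR (phi q) * g q (Y q) (Z q)) =
        X p (expR \o phi) * g p (Y p) (Z p) + expR (phi p) * X p (fun q => g q (Y q) (Z q)).
      apply: (tangent_mulf hM tX (f := expR \o phi)).
        exact: smooth_on_at sexp.
      by apply: (smooth_on_at oU Up); exact: (metric_smooth me).
    rewrite (tangent_compf hM tX (dh := expR (phi p))); [|exact: smooth_on_at sphi|exact: smooth_on_at sexp].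
    have g3 (v1 v2 v3 w : tvec R M) (a b : R) : tangent p v1 -> tangent p v2 ->
        tangent p v3 -> tangent p w ->
        g p (v1 + a *: v2 + b *: v3) w = g p v1 w + a * g p v2 w + b * g p v3 w.
      move=> t1 t2 t3 tw; rewrite addrC (metric_linear me) //; last first.
        by rewrite addrC; exact: tangent_lin.
      by rewrite [v1 + _]addrC (metric_linear me) //; ring.
    have tN : tangent p (nabla X Z p + X p phi *: Z p + Z p phi *: X p).
      exact: (tangentD hM (tangentD hM tXZ (tangentZ hM _ tZ)) (tangentZ hM _ tX)).
    rewrite !proj_nablaE g3 // (Defs.metric_sym me Up tY tN).
    rewrite g3 // (Defs.metric_sym me Up tXZ tY) (Defs.metric_sym me Up tZ tY) (Defs.metric_sym me Up tX tZ).
    rewrite (Defs.metric_sym me Up tX tY).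
    ring.
  move=> X Y Z sX sY sZ p Up.
  have tX := vf_tangent sX Up; have tY := vf_tangent sY Up; have tZ := vf_tangent sZ Up.
  rewrite !E // (Defs.metric_sym me Up tY tX) (Defs.metric_sym me Up tZ tY).
  have [-> <-] := stat_symmetric hS sX sY sZ Up.
  by split; [|rewrite -(stat_symmetric hS sX sY sZ Up).1]; ring.
Qed.

(** The projective change adds to R(X,Y)Z the terms H(X,Z) Y - H(Y,Z) X, where
    H = Hess phi - dphi dphi; when H = K g they cancel the constant
    curvature. *)
Lemma proj_flat (K : R) :
  (forall X Y Z, smooth_vfield U X -> smooth_vfield U Y ->
   smooth_vfield U Z -> forall p, U p ->
   curvature A nabla X Y Z p = K *: (g p (Y p) (Z p) *: X p - g p (X p) (Z p) *: Y p)) ->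
  (forall X Z, smooth_vfield U X -> smooth_vfield U Z -> forall p, U p ->
    X p (fun q => Z q phi) - nabla X Z p phi - X p phi * Z p phi =
    K * g p (X p) (Z p)) ->
  flat A U proj_nabla.
Proof.
move=> HK HH X Y Z sX sY sZ p Up.
have UU := @subset_refl _ U.
have E X1 Y1 : smooth_vfield U X1 -> smooth_vfield U Y1 ->
  proj_nabla X1 (proj_nabla Y1 Z) p =
   (nabla X1 (nabla Y1 Z) p + (X1 p (fun q => Y1 q phi) *: Z p + Y1 p phi *: nabla X1 Z p)
    + (X1 p (fun q => Z q phi) *: Y1 p + Z p phi *: nabla X1 Y1 p))
   + X1 p phi *: (nabla Y1 Z p + Y1 p phi *: Z p + Z p phi *: Y1 p)
   + (nabla Y1 Z p phi + Y1 p phi * Z p phi + Z p phi * Y1 p phi) *: X1 p.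
  move=> s1 s2; have sn := connection_smooth cn oU UU s2 sZ.
  have sa X2 (s : smooth_vfield U X2) := sapp oU UU s.
  rewrite proj_nablaE {1}/proj_nabla.
  have e1 := smooth_vfield_vscale hM (sa _ s2) sZ.
  have e2 := smooth_vfield_vscale hM (sa _ sZ) s2.
  have e3 := smooth_vfield_vadd hM sn e1.
  rewrite (connection_addr cn oU UU s1 e3 e2 Up).
  rewrite (connection_addr cn oU UU s1 sn e1 Up).
  rewrite (connection_leibniz cn oU UU (sa _ s2) s1 sZ Up).
  by rewrite (connection_leibniz cn oU UU (sa _ sZ) s1 s2 Up).
rewrite /curvature !E // proj_nablaE; apply/funext => f.
have := HK X Y Z sX sY sZ p Up; rewrite /curvature => /(congr1 (fun v : tvec R M => v f)).
have := stat_torsion_free hS sX sY Up => /(congr1 (fun v : tvec R M => v f)).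
have bphi : bracket A X Y p phi = X p (fun q => Y q phi) - Y p (fun q => X q phi).
  by rewrite /bracket asboolT //; exact: smooth_on_at sphi.
have hX := HH _ _ sX sZ p Up; have hY := HH _ _ sY sZ p Up.
rewrite !(fctE, scale_realE) bphi => hb hR.
rewrite -hb.
have -> : X p (fun q => Z q phi) = nabla X Z p phi + X p phi * Z p phi + K * g p (X p) (Z p).
  by rewrite -hX; ring.
have -> : Y p (fun q => Z q phi) = nabla Y Z p phi + Y p phi * Z p phi + K * g p (Y p) (Z p).
  by rewrite -hY; ring.
have -> : nabla X (nabla Y Z) p f = nabla Y (nabla X Z) p f + nabla (bracket A X Y) Z p f
   + K * (g p (Y p) (Z p) * X p f - g p (X p) (Z p) * Y p f).
  by move: hR => /= <-; ring.
transitivity (0 : R); last by [].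
ring.
Qed.

Lemma grad0 p : U p -> grad A g (fun=> 0) p = 0.
Proof.
move=> Up; rewrite /grad; case: xgetP => // w _ [tw gw].
apply: contrapT => w0; have := metric_pos me Up tw w0.
by rewrite gw // (tangent_cst hM tw) ltxx.
Qed.

Lemma proj_equivalent :
  conformally_projectively_equivalent A U g nabla proj_metric proj_nabla.
Proof.
exists phi, (fun=> 0); split => //; first exact: smooth_on_cst.
move=> X Y sX sY p Up; split; first by rewrite addr0.
by rewrite grad0 // scaler0 subr0.
Qed.

End ProjectiveChange.
End Connection.

(** * The Hessian equation in coordinates *)

(** The scalar identities to which the integrability conditions reduce once the
    curvature and Codazzi equations are read in coordinates. *)

Lemma cancel_middle {R : realType} (a b n1 n2 s1 s2 t1 t2 : R) :
  a - n1 - s1 = b - n2 - s2 -> n1 = n2 -> s1 = t1 -> s2 = t2 -> a - t1 = b - t2.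
Proof. lra. Qed.

Lemma integrable_SomeSome {R : realType} (K a b s t x y d e : R) :
  (a + s) - (b + t) = K * (x * d - y * e) ->
  a + (- K * x * d + s) = b + (- K * y * e + t).
Proof. by move=> H; apply/eqP; rewrite -subr_eq0 -(subrr (K * (x * d - y * e))) -{1}H; apply/eqP; ring. Qed.

Lemma integrable_SomeNone {R : realType} (K a b s t x y a' b' s' t' : R) :
  a - s = b - t -> a' = - K * a -> b' = - K * b -> t' = - K * t ->
  s' = - K * s -> a' + (x * 0 + t') = b' + (y * 0 + s').
Proof.
move=> H -> -> -> ->; rewrite !mulr0 !add0r -!mulrDr; congr (_ * _); lra.
Qed.

Lemma integrable_None {R : realType} (a b s s' t x y : R) :
  a = 0 -> b = 0 -> s = t -> s' = t -> a + (0 * x + s) = b + (0 * y + s').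
Proof. by move=> -> -> -> ->; rewrite !mul0r. Qed.

Section Coordinates.
Context {R : realType} {n : nat} {M : topologicalType} {A : set (chart R M n)}.
Hypothesis hM : smooth_manifold A.
Implicit Types (U V W : set M) (p q : M) (f : M -> R).
Implicit Types (u v w : tvec R M) (X Y Z : vfield R M).
Local Notation smooth_on := (smooth_on A).
Local Notation smooth_at := (smooth_at A).
Local Notation tangent := (tangent A).
Local Notation smooth_vfield := (smooth_vfield A).
Local Notation partial := (partial (A := A)).

Let vf_tangent W X p : smooth_vfield W X -> W p -> tangent p (X p).
Proof. by case=> + _; exact. Qed.

Lemma tvec_sumE (I : Type) (r : seq I) (a : I -> R) (u : I -> tvec R M) f :
  (\sum_(k <- r) a k *: u k) f = \sum_(k <- r) a k * u k f.
Proof. by rewrite fct_sumE; apply: eq_bigr. Qed.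

Lemma smooth_vfield_sum W (I : Type) (r : seq I) (a : I -> M -> R)
    (Y : I -> vfield R M) : open W -> (forall k, smooth_on W (a k)) ->
  (forall k, smooth_vfield W (Y k)) ->
  smooth_vfield W (fun q => \sum_(k <- r) a k q *: Y k q).
Proof.
move=> oW sa sY; elim: r => [|k r IH].
  apply: (smooth_vfield_eq (Y := fun=> 0)) => //; last exact: smooth_vfield0.
  by move=> q _; rewrite big_nil.
apply: (smooth_vfield_eq (Y := vadd (vscale (a k) (Y k))
    (fun q => \sum_(k <- r) a k q *: Y k q))) => //.
  by move=> q _; rewrite big_cons.
by apply: smooth_vfield_vadd => //; exact: smooth_vfield_vscale.
Qed.

(** Induction on the decomposition of a vector field along the coordinate
    vector fields, used to test tensorial identities on the latter only. *)
Lemma smooth_vfield_ind c W (P : vfield R M -> Prop) : A c -> open W ->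
  W `<=` chart_dom c ->
  (forall X Y, (forall q, W q -> X q = Y q) -> smooth_vfield W X ->
    smooth_vfield W Y -> P X -> P Y) ->
  (forall X Y, smooth_vfield W X -> smooth_vfield W Y -> P X -> P Y ->
    P (vadd X Y)) ->
  (forall f X, smooth_on W f -> smooth_vfield W X -> P X -> P (vscale f X)) ->
  (forall i, P (partial c i)) -> P (fun=> 0) ->
  forall X, smooth_vfield W X -> P X.
Proof.
move=> Ac oW Wc Peq Padd Pscale PE P0 X sX.
pose a i q := X q (fun q' => c q' 0 i).
have sa i : smooth_on W (a i).
  apply: smooth_vfield_app => //; apply: smooth_on_sub Wc _.
  exact: smooth_on_coord.
have sE i : smooth_vfield W (partial c i).
  by apply: smooth_vfield_sub Wc _; exact: smooth_partial.
have sS r := smooth_vfield_sum r oW sa sE.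
apply: (Peq (fun q => \sum_i a i q *: partial c i q)) => //.
  move=> q Wq; apply/esym; apply: tangent_sum_partial => //; first exact: Wc.
  exact: vf_tangent sX Wq.
elim: (index_enum _) => [|i r IH].
  apply: (Peq (fun=> 0)) => //; last exact: smooth_vfield0.
  by move=> q _; rewrite big_nil.
apply: (Peq (vadd (vscale (a i) (partial c i))
    (fun q => \sum_(k <- r) a k q *: partial c k q))) => //.
- by move=> q _; rewrite big_cons.
- by apply: smooth_vfield_vadd => //; exact: smooth_vfield_vscale.
- by apply: Padd => //; [exact: smooth_vfield_vscale | exact: Pscale].
Qed.

Lemma sum_delta (m : 'I_n) (F : 'I_n -> R) : \sum_k F k * (k == m)%:R = F m.
Proof.
rewrite (bigD1 m) //= eqxx mulr1 big1 ?addr0 // => k km.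
by rewrite (negbTE km) mulr0.
Qed.

Lemma sum_option (F : option 'I_n -> R) : \sum_a F a = F None + \sum_i F (Some i).
Proof.
rewrite (bigD1 None) //=; congr (_ + _).
rewrite (reindex_omap Some id) /=; last by case.
by apply: eq_bigl => i; rewrite eqxx.
Qed.

Variables (g : metric R M) (nabla : connection R M) (K : R).
Hypothesis hS : statistical_manifold A setT g nabla.
Hypothesis HK : forall X Y Z, smooth_vfield setT X -> smooth_vfield setT Y ->
   smooth_vfield setT Z -> forall p, setT p ->
   curvature A nabla X Y Z p = K *: (g p (Y p) (Z p) *: X p - g p (X p) (Z p) *: Y p).

Let cn := stat_connection hS.
Let me := stat_metric hS.

Let cn_smooth W X Y : open W -> smooth_vfield W X -> smooth_vfield W Y ->
  smooth_vfield W (nabla X Y).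
Proof. by move=> oW; apply: (connection_smooth cn oW). Qed.

Let nloc W X X' Y Y' p : open W -> W p ->
  smooth_vfield W X -> smooth_vfield W X' ->
  smooth_vfield W Y -> smooth_vfield W Y' ->
  (forall q, W q -> X q = X' q) -> (forall q, W q -> Y q = Y' q) ->
  nabla X Y p = nabla X' Y' p.
Proof. by move=> oW Wp; apply: (nabla_local hM cn). Qed.

Lemma nabla0r W X p : open W -> smooth_vfield W X -> W p -> nabla X (fun=> 0) p = 0.
Proof.
move=> oW sX Wp; have -> : (fun=> 0) = vscale (fun=> 0) X.
  by apply/funext => q; rewrite /vscale scale0r.
rewrite (connection_leibniz cn oW) //; last exact: smooth_on_cst.
by rewrite (tangent_cst hM (vf_tangent sX Wp)) !scale0r addr0.
Qed.

Lemma nabla0l W Y p : open W -> smooth_vfield W Y -> W p -> nabla (fun=> 0) Y p = 0.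
Proof.
move=> oW sY Wp; have -> : (fun=> 0) = vscale (fun=> 0) Y.
  by apply/funext => q; rewrite /vscale scale0r.
by rewrite (connection_scalel cn oW) // ?scale0r //; exact: smooth_on_cst.
Qed.

Lemma nabla_sum W X (I : Type) (r : seq I) (a : I -> M -> R) (Y : I -> vfield R M) p :
  open W -> W p -> smooth_vfield W X -> (forall k, smooth_on W (a k)) ->
  (forall k, smooth_vfield W (Y k)) ->
  nabla X (fun q => \sum_(k <- r) a k q *: Y k q) p =
  \sum_(k <- r) (X p (a k) *: Y k p + a k p *: nabla X (Y k) p).
Proof.
move=> oW Wp sX sa sY; elim: r => [|k r IH].
  rewrite big_nil (_ : (fun _ => _) = fun=> 0); first exact: nabla0r oW sX Wp.
  by apply/funext => q; rewrite big_nil.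
rewrite big_cons -IH -(connection_leibniz cn oW) //.
rewrite -(connection_addr cn oW) //.
- by congr (nabla X _ p); apply/funext => q; rewrite big_cons.
- exact: (smooth_vfield_vscale hM (sa k) (sY k)).
- exact: (smooth_vfield_sum r oW sa sY).
Qed.

Lemma metric_sum (I : Type) (r : seq I) (a : I -> R) (u : I -> tvec R M) v p :
  tangent p v -> (forall k, tangent p (u k)) ->
  g p v (\sum_(k <- r) a k *: u k) = \sum_(k <- r) a k * g p v (u k).
Proof.
move=> tv tu.
have t0 := tangent0 hM p.
have lin b u1 u2 : tangent p u1 -> tangent p u2 ->
    g p v (b *: u1 + u2) = b * g p v u1 + g p v u2.
  by move=> t1 t2; apply: (metric_linearr hM hS).
have tS s : tangent p (\sum_(k <- s) a k *: u k).
  elim: s => [|k s IH]; first by rewrite big_nil.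
  by rewrite big_cons; exact: tangent_lin.
elim: r => [|k r IH]; last by rewrite !big_cons lin // IH.
by rewrite !big_nil; have := lin (-1) _ _ t0 t0; rewrite scaleN1r addNr mulN1r addNr.
Qed.

Section Chart.
Variable c : chart R M n.
Hypothesis Ac : A c.
Let D := chart_dom c.
Let oD : open D. Proof. exact: chart_dom_open. Qed.
Local Notation E i := (partial c i).
Local Notation coord k := (fun q : M => c q 0 k).

Let sE i : smooth_vfield D (E i). Proof. exact: smooth_partial. Qed.
Let tE i p : D p -> tangent p (E i p). Proof. exact: vf_tangent. Qed.

Definition christoffel i j k p : R := nabla (E i) (E j) p (coord k).
Definition metric_coef i j p : R := g p (E i p) (E j p).
Local Notation Gam := christoffel.
Local Notation gm := metric_coef.

Let sGam i j k : smooth_on D (Gam i j k).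
Proof.
by apply: smooth_vfield_app => //; [exact: cn_smooth | exact: smooth_on_coord].
Qed.

Let sgm i j : smooth_on D (gm i j).
Proof. by apply: (metric_smooth me). Qed.

Let nablaE i j p : D p -> nabla (E i) (E j) p = \sum_k Gam i j k p *: E k p.
Proof.
move=> Dp; apply: tangent_sum_partial => //.
by apply: vf_tangent Dp; exact: cn_smooth.
Qed.

Let tf : torsion_free A D nabla. Proof. exact (torsion_free_restrict hM hS oD). Qed.

(** Torsion-freeness makes the bracket a tangent vector; it vanishes because
    it kills the coordinates. *)
Lemma bracket_partial i j p : D p -> bracket A (E i) (E j) p = 0.
Proof.
move=> Dp; apply: (tangent_ext hM Ac Dp).
- rewrite -tf // -scaleN1r addrC; apply: tangent_lin => //;
  by apply: vf_tangent Dp; exact: cn_smooth.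
- exact: tangent0.
- move=> k; rewrite /bracket asboolT; last exact: smooth_at_coord.
  have z l m : E l p (fun q => E m q (coord k)) = 0.
    rewrite (tangent_local hM (tE l Dp) oD Dp (g := fun=> (m == k)%:R)).
      exact: tangent_cst (tE l Dp) _.
    by move=> q Dq; exact: partial_coord.
  by rewrite !z subrr.
Qed.

Let nabla_sym i j p : D p -> nabla (E i) (E j) p = nabla (E j) (E i) p.
Proof.
by move=> Dp; apply/eqP; rewrite -subr_eq0 tf // bracket_partial.
Qed.

Lemma codazzi_coef l i j p : D p ->
  E l p (gm i j) - \sum_k Gam l j k p * gm i k p =
  E i p (gm l j) - \sum_k Gam i j k p * gm l k p.
Proof.
move=> Dp.
have expand h m s : g p (E h p) (nabla (E m) (E s) p) =
    \sum_k Gam m s k p * gm h k p.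
  apply: etrans (congr1 (g p (E h p)) (nablaE m s Dp)) _.
  exact: (metric_sum _ _ (tE h Dp) (fun k => tE k Dp)).
have sym := congr1 (fun v => g p v (E j p)) (nabla_sym l i Dp).
have [H _] := cov_metric_symmetric_restrict hM hS oD (sE l) (sE i) (sE j) Dp.
exact: (cancel_middle H sym (expand _ _ _) (expand _ _ _)).
Qed.

Lemma curvature_coef l i j m p : D p ->
  (E l p (Gam i j m) + \sum_k Gam i j k p * Gam l k m p) -
  (E i p (Gam l j m) + \sum_k Gam l j k p * Gam i k m p) =
  K * (gm i j p * (l == m)%:R - gm l j p * (i == m)%:R).
Proof.
move=> Dp.
have N2 l' i' : nabla (E l') (nabla (E i') (E j)) p (coord m) =
   E l' p (Gam i' j m) + \sum_k Gam i' j k p * Gam l' k m p.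
  have -> : nabla (E l') (nabla (E i') (E j)) p =
      nabla (E l') (fun q => \sum_k Gam i' j k q *: E k q) p.
    apply: (nloc oD Dp) => //; first exact: cn_smooth.
      by apply: smooth_vfield_sum.
    by move=> q Dq; exact: nablaE.
  rewrite (nabla_sum _ oD Dp) // big_split /=.
  transitivity ((\sum_k E l' p (Gam i' j k) *: E k p) (coord m) +
      (\sum_k Gam i' j k p *: nabla (E l') (E k) p) (coord m)); first by [].
  rewrite !tvec_sumE; congr (_ + _).
  rewrite -[RHS](sum_delta m (fun k => E l' p (Gam i' j k))).
  by apply: eq_bigr => k _; rewrite partial_coord.
have := constant_curvature_restrict hM hS HK oD (sE l) (sE i) (sE j) Dp.
move=> /(congr1 (fun v : tvec R M => v (coord m))).
rewrite /curvature.
have -> : nabla (bracket A (E l) (E i)) (E j) p = 0.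
  rewrite -(nabla0l oD (sE j) Dp); apply: (nloc oD Dp) => //.
  - apply: (bracket_smooth hM (U := D) (nabla := nabla)) => //.
    by case: (statistical_manifold_restrict hM hS oD).
  - exact: smooth_vfield0.
  - by move=> q Dq; exact: bracket_partial.
rewrite subr0 => H.
transitivity (nabla (E l) (nabla (E i) (E j)) p (coord m) -
    nabla (E i) (nabla (E l) (E j)) p (coord m)); first by rewrite !N2.
rewrite [LHS]H.
transitivity (K * (gm i j p * E l p (coord m) - gm l j p * E i p (coord m))); first by [].
by rewrite !partial_coord.
Qed.

(** The unknowns are a function u (index [None]) and its partial derivatives
    (indices [Some j]); the equations say that the Hessian of u is - K u g. *)
Definition hessian_system (i : 'I_n) (a b : option 'I_n) : M -> R :=
  match a, b with
  | None, None => fun=> 0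
  | None, Some k => fun=> (i == k)%:R
  | Some j, None => fun p => - K * gm i j p
  | Some j, Some k => Gam i j k
  end.

Lemma hessian_system_smooth i a b : smooth_on D (hessian_system i a b).
Proof.
case: a b => [j|] [k|] /=; [exact: sGam| |exact: smooth_on_cst|exact: smooth_on_cst].
by apply: smooth_on_mul => //; exact: smooth_on_cst.
Qed.

(** The four cases are: the Gauss equation, that is constant curvature; the
    Codazzi equation, that is the symmetry of nabla g; the symmetry of the
    Christoffel symbols; and the symmetry of the metric. *)
Lemma hessian_system_integrable i j a b p : D p ->
  E j p (hessian_system i a b) +
    \sum_c hessian_system i a c p * hessian_system j c b p =
  E i p (hessian_system j a b) +
    \sum_c hessian_system j a c p * hessian_system i c b p.
Proof.
move=> Dp; rewrite !sum_option.
have gs l k : gm l k p = gm k l p.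
  by rewrite /metric_coef (Defs.metric_sym me) //; exact: tE.
have sumd l (F : 'I_n -> R) : \sum_k (l == k)%:R * F k = F l.
  by rewrite -[RHS](sum_delta l F); apply: eq_bigr => k _; rewrite mulrC eq_sym.
have Es l k m : Gam l k m p = Gam k l m p by rewrite /christoffel nabla_sym.
have cst0 l a0 : E l p (fun=> a0) = 0 by exact: tangent_cst (tE l Dp) _.
case: a b => [k|] [m|] /=.
- exact: (integrable_SomeSome (curvature_coef j i k m Dp)).
- have der l h : E l p (fun q => - K * gm h k q) = - K * E l p (gm h k).
    have tl := tE l Dp.
    rewrite (tangent_mulf hM tl (f := fun=> - K)) ?cst0 ?mul0r ?add0r //.
      by apply: (smooth_on_at oD Dp); exact: smooth_on_cst.
    exact: smooth_on_at (sgm _ _).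
  have pull h l : \sum_q Gam h k q p * (- K * gm l q p) =
      - K * \sum_q Gam h k q p * gm l q p.
    by rewrite mulr_sumr; apply: eq_bigr => q _; exact: mulrCA.
  exact: (integrable_SomeNone _ _ (codazzi_coef j i k Dp) (der j i) (der i j)
    (pull i j) (pull j i)).
- exact: (integrable_None _ _ (cst0 j _) (cst0 i _) (sumd i (fun k => Gam j k m p))
    (etrans (sumd j (fun k => Gam i k m p)) (Es _ _ _))).
- exact: (integrable_None _ _ (cst0 j _) (cst0 i _) (sumd i (fun k => - K * gm j k p))
    (etrans (sumd j (fun k => - K * gm i k p)) (congr1 _ (gs _ _)))).
Qed.

(** The equation is tensorial in both arguments. *)
Let hessian_ext U : open U -> U `<=` D -> forall f, smooth_on U f ->
  (forall i j p, U p -> E i p (fun q => E j q f) - nabla (E i) (E j) p f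
     + K * f p * gm i j p = 0) ->
  forall X Z, smooth_vfield U X -> smooth_vfield U Z -> forall p, U p ->
    X p (fun q => Z q f) - nabla X Z p f + K * f p * g p (X p) (Z p) = 0.
Proof.
move=> oU UD f sf H.
pose T X Z p := X p (fun q => Z q f) - nabla X Z p f + K * f p * g p (X p) (Z p).
have sEU i : smooth_vfield U (E i) by exact: smooth_vfield_sub (sE i).
have loc X X' Z Z' p : U p -> smooth_vfield U X -> smooth_vfield U X' ->
   smooth_vfield U Z -> smooth_vfield U Z' -> (forall q, U q -> X q = X' q) ->
   (forall q, U q -> Z q = Z' q) -> T X Z p = T X' Z' p.
  move=> Up sX sX' sZ sZ' EX EZ; rewrite /T (nloc oU Up sX sX' sZ sZ') // -EX // -EZ //.
  congr (_ - _ + _); apply: (tangent_local hM (vf_tangent sX Up) oU Up) => q Uq.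
  by rewrite EZ.
have sapp Z : smooth_vfield U Z -> smooth_on U (fun q => Z q f).
  by move=> sZ; exact: smooth_vfield_app.
have s0 := @smooth_vfield0 _ _ _ _ hM U.
have tz p := tangent0 hM p.
have g0l p w : tangent p w -> g p 0 w = 0.
  move=> tw; have := metric_linear me I (-1) (tz p) (tz p) tw.
  by rewrite scaleN1r addNr mulN1r addNr.
have g0r p w : tangent p w -> g p w 0 = 0.
  by move=> tw; rewrite (Defs.metric_sym me) // g0l.
have H1 j : forall X, smooth_vfield U X -> forall p, U p -> T X (E j) p = 0.
  apply: (smooth_vfield_ind (P := fun X => forall p, U p -> T X (E j) p = 0) Ac oU UD).
  - by move=> X1 X2 E12 s1 s2 H1 p Up; rewrite -(loc X1 _ (E j)) // H1.
  - move=> X1 X2 s1 s2 H1 H2 p Up; rewrite -[RHS]addr0 -{1}(H1 p Up) -(H2 p Up) /T.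
    rewrite (connection_addl cn oU) // /vadd.
    have := metric_linear me I 1 (vf_tangent s1 Up) (vf_tangent s2 Up) (vf_tangent (sEU j) Up).
    rewrite scale1r mul1r => ->; rewrite !fctE; ring.
  - move=> h X1 sh s1 H1 p Up; rewrite -[RHS](mulr0 (h p)) -(H1 p Up) /T.
    rewrite (connection_scalel cn oU) // /vscale.
    have := metric_linear me I (h p) (vf_tangent s1 Up) (tz p) (vf_tangent (sEU j) Up).
    rewrite addr0 g0l ?addr0; last exact: vf_tangent (sEU j) Up.
    by move=> ->; rewrite !(fctE, scale_realE); ring.
  - by move=> i p Up; exact: H.
  - move=> p Up; rewrite /T (nabla0l oU (sEU j) Up) g0l; last exact: vf_tangent (sEU j) Up.
    by rewrite mulr0 addr0 subrr.
move=> X Z sX; move: Z.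
apply: (smooth_vfield_ind (P := fun Z => forall p, U p -> T X Z p = 0) Ac oU UD).
- by move=> Z1 Z2 E12 s1 s2 H2 p Up; rewrite -(loc X _ Z1) // H2.
- move=> Z1 Z2 s1 s2 H2 H3 p Up; rewrite -[RHS]addr0 -{1}(H2 p Up) -(H3 p Up) /T.
  have tX := vf_tangent sX Up.
  rewrite (connection_addr cn oU) // /vadd.
  have := metric_linearr hM hS 1 I (vf_tangent s1 Up) (vf_tangent s2 Up) tX.
  rewrite scale1r mul1r => ->.
  have -> : X p (fun q => (Z1 q + Z2 q) f) = X p (fun q => Z1 q f) + X p (fun q => Z2 q f).
    by apply: (tangent_addf hM tX); apply: (smooth_on_at oU Up); exact: sapp.
  rewrite !fctE; ring.
- move=> h Z1 sh s1 H2 p Up; rewrite -[RHS](mulr0 (h p)) -(H2 p Up) /T.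
  have tX := vf_tangent sX Up.
  rewrite (connection_leibniz cn oU) // /vscale.
  have := metric_linearr hM hS (h p) I (vf_tangent s1 Up) (tz p) tX.
  rewrite addr0 g0r // addr0 => ->.
  have -> : X p (fun q => (h q *: Z1 q) f) = X p h * Z1 p f + h p * X p (fun q => Z1 q f).
    apply: (tangent_mulf hM tX); first exact: smooth_on_at sh.
    by apply: (smooth_on_at oU Up); exact: sapp.
  rewrite !(fctE, scale_realE); ring.
- by move=> j p Up; exact: H1.
- move=> p Up; have tX := vf_tangent sX Up.
  rewrite /T (nabla0r oU sX Up) g0r // mulr0 addr0.
  by rewrite [X in X - _](tangent_cst hM tX) subrr.
Qed.

Lemma hessian_solution p0 : D p0 -> exists U (u : M -> R),
  [/\ open U, U p0, smooth_on U u, forall p, U p -> 0 < u p &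
    forall X Z, smooth_vfield U X -> smooth_vfield U Z -> forall p, U p ->
    X p (fun q => Z q u) - nabla X Z p u + K * u p * g p (X p) (Z p) = 0].
Proof.
move=> Dp0.
have oO : open (c @` D) by exact: chart_img_open.
have DE : chart_dom c `&` D = D by rewrite setIid.
pose B i a b := hessian_system i a b \o chart_inv c.
have cB i a b : Cinfty (c @` D) (B i a b).
  by have := hessian_system_smooth i a b Ac; rewrite DE.
have intB i j a b x : (c @` D) x ->
    'D_(delta_mx 0 j) (B i a b) x + \sum_l B i a l x * B j l b x =
    'D_(delta_mx 0 i) (B j a b) x + \sum_l B j a l x * B i l b x.
  move=> [p Dp <-].
  have := hessian_system_integrable i j a b Dp.
  rewrite !partialE; try exact: smooth_on_at (hessian_system_smooth _ _ _).
  by rewrite /B /= chart_mapK.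
have Op0 : (c @` D) (c p0) by exists p0.
(* Initial values: u = 1 and du = 0 at p0. *)
have [D' [y [oD' D'p0 D'O sy [y0 Dy]]]] := linear_frobenius oO Op0 cB intB
  (fun a => if a is None then 1 else 0).
pose P := D' `&` [set x | 0 < y None x].
pose U := D `&` (c @^-1` P).
have oU : open U.
  rewrite openE => q [Dq [D'q yq]]; apply: filterI; first exact: open_nbhs_nbhs.
  apply: (chart_map_cont Dq); apply: filterI; first exact: open_nbhs_nbhs.
  have cy : {for c q, continuous (y None)} by exact: (sy None 0%N).
  exact: (cy _ (lt_nbhsr yq)).
have UD : U `<=` D by move=> q [].
pose z a q := y a (c q).
have sz a : smooth_on U (z a).
  apply: (smooth_on_chart hM Ac oU UD) => k.
  have oI : open (c @` U) by rewrite -(setIidr UD); exact: chart_image_open.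
  apply: (@Ck_eq _ _ R _ _ _ (y a)) => //.
    by move=> _ [q [Dq _] <-]; rewrite /z /= chart_mapK.
  by apply: Ck_sub (sy a k) => _ [q [_ [D'q _]] <-].
have Dz i a p : U p -> E i p (z a) = \sum_b hessian_system i a b p * z b p.
  move=> Up; have [Dp [D'p _]] := Up.
  rewrite partialE; last exact: smooth_on_at (sz a).
  have -> : 'D_(delta_mx 0 i) (z a \o chart_inv c) (c p) = 'D_(delta_mx 0 i) (y a) (c p).
    apply: near_eq_derive; apply: (near_chart Dp oD Dp) => q Dq _.
    by rewrite /z /= chart_mapK.
  rewrite Dy //; apply: eq_bigr => b _.
  by rewrite /B /= chart_mapK.
have Dz0 i p : U p -> E i p (z None) = z (Some i) p.
  move=> Up; rewrite Dz // sum_option mul0r add0r /=.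
  rewrite -[RHS](sum_delta i (fun k => z (Some k) p)).
  by apply: eq_bigr => k _; rewrite mulrC eq_sym.
exists U, (z None); split => //.
- by split => //; split => //=; rewrite y0.
- by move=> p [_ []].
- apply: (hessian_ext oU UD (sz None)) => i j p Up.
  have Dp := UD _ Up.
  rewrite (tangent_local hM (tE i Dp) oU Up (g := z (Some j))); last first.
    by move=> q Uq; exact: Dz0.
  have ES : \sum_k Gam i j k p * E k p (z None) =
      \sum_k Gam i j k p * z (Some k) p.
    by apply: eq_bigr => k _; rewrite Dz0.
  rewrite Dz // sum_option /= nablaE // tvec_sumE ES.
  by rewrite addrK mulrAC !mulNr addNr.
Qed.

End Chart.

Lemma inv_smooth : Cinfty [set t : R | 0 < t] (fun t => - t^-1).
Proof.
have oP : open [set t : R | 0 < t] by exact: open_gt.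
move=> k; apply: (@Ck_eq _ R R _ _ _ (fun t => - 1 * t^-1)) => //.
  by move=> t _; rewrite mulN1r.
apply: Ck_mul => //; first exact: Ck_cst.
by apply: Ck_inv => //; [move=> t /lt0r_neq0 | exact: Ck_id].
Qed.

Lemma Nln_derive (t : R) : 0 < t -> is_derive t 1 (fun s : R => - ln s) (- t^-1).
Proof. by move=> t0; have := is_derive1_ln t0 => H; exact: is_deriveN. Qed.

Lemma Nln_smooth : Cinfty [set t : R | 0 < t] (fun t => - ln t).
Proof.
have oP : open [set t : R | 0 < t] by exact: open_gt.
have df (t : R) : 0 < t -> differentiable (fun t : R => - ln t) t.
  by move=> t0; apply/derivable1_diffP; have [] := Nln_derive t0.
case=> [|k]; first by move=> t t0; exact: differentiable_continuous (df t t0).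
apply: (@CkS R R R k _ _ (fun v t : R => v * - t^-1)) => //.
- move=> v t t0; rewrite deriveE ?diff1E ?derive1E //; try exact: df.
  by have [_ ->] := Nln_derive t0.
- by move=> v; apply: Ck_mul => //; [exact: Ck_cst | exact: inv_smooth].
Qed.

Lemma Ninv_derive (t : R) : 0 < t -> is_derive t 1 (fun s : R => - s^-1) (t^-1 ^+ 2).
Proof.
move=> t0; have tn0 : t != 0 by rewrite gt_eqF.
have Di := @is_deriveV R id t 1 1 tn0 (is_derive_id t 1).
have := is_deriveN Di => H; apply: is_derive_eq H _.
by rewrite [_ *: _]mulr1 opprK exprVn.
Qed.

(** For phi = - ln u, Hess phi = - Hess u / u + dphi dphi. *)
Lemma log_hessian U (u : M -> R) : open U -> smooth_on U u ->
  (forall p, U p -> 0 < u p) ->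
  (forall X Z, smooth_vfield U X -> smooth_vfield U Z -> forall p, U p ->
    X p (fun q => Z q u) - nabla X Z p u + K * u p * g p (X p) (Z p) = 0) ->
  let phi := (fun t => - ln t) \o u in smooth_on U phi /\
  forall X Z, smooth_vfield U X -> smooth_vfield U Z -> forall p, U p ->
    X p (fun q => Z q phi) - nabla X Z p phi - X p phi * Z p phi =
    K * g p (X p) (Z p).
Proof.
move=> oU su u0 H phi.
have oP : open [set t : R | 0 < t] by exact: open_gt.
have sphi : smooth_on U phi by apply: (smooth_on_comp oU oP u0 su); exact: Nln_smooth.
have sinv : smooth_on U ((fun t => - t^-1) \o u).
  by apply: (smooth_on_comp oU oP u0 su); exact: inv_smooth.
split => // X Z sX sZ p Up.
have vphi v q : U q -> tangent q v -> v phi = - (u q)^-1 * v u.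
  move=> Uq tv; apply: (tangent_compf hM tv); [exact: smooth_on_at su|exact: smooth_on_at sphi|].
  exact: Nln_derive (u0 _ Uq).
have tX := vf_tangent sX Up; have tZ := vf_tangent sZ Up.
have tN := vf_tangent (cn_smooth oU sX sZ) Up.
rewrite (vphi _ p Up tX) (vphi _ p Up tZ) (vphi _ p Up tN).
have -> : X p (fun q => Z q phi) = X p (fun q => ((fun t => - t^-1) \o u) q * Z q u).
  by apply: (tangent_local hM tX oU Up) => q Uq; rewrite (vphi _ q) //; exact: vf_tangent sZ Uq.
rewrite (tangent_mulf hM tX); [|exact: smooth_on_at sinv|]; last first.
  by apply: (smooth_on_at oU Up); exact: smooth_vfield_app.
have -> : X p ((fun t => - t^-1) \o u) = (u p)^-1 ^+ 2 * X p u.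
  apply: (tangent_compf hM tX); [exact: smooth_on_at su|exact: smooth_on_at sinv|].
  exact: Ninv_derive (u0 _ Up).
have un0 : u p != 0 by rewrite gt_eqF // u0.
have := H X Z sX sZ p Up => /eqP; rewrite addr_eq0 => /eqP E.
have -> : X p (fun q => Z q u) = nabla X Z p u - K * u p * g p (X p) (Z p).
  by rewrite -E; ring.
by rewrite /=; field.
Qed.

End Coordinates.

Theorem theorem3p1 (R : realType) (n : nat) (M : topologicalType)
    (A : set (chart R M n)) (g : metric R M) (nabla : connection R M)
    (hM : smooth_manifold A) (hn : (4 <= n)%N)
    (hstat : statistical_manifold A setT g nabla)
    (hcurv : constant_curvature A setT g nabla) :
  conformally_projectively_flat A g nabla.
Proof.
move: hcurv => [K HK] p.
have [c Ac cp] := manifold_cover hM p.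
have [U [u [oU Up su u0 Hu]]] := hessian_solution hM hstat HK Ac cp.
have [sphi Hphi] := log_hessian hM hstat oU su u0 Hu.
have hU := statistical_manifold_restrict hM hstat oU.
exists U, (proj_metric g (fun q => - ln (u q))), (proj_nabla nabla (fun q => - ln (u q))).
split => //.
- exact: proj_statistical.
- apply: (proj_flat hM hU oU sphi (K := K)) => //.
  by move=> X Y Z sX sY sZ q Uq; exact: (constant_curvature_restrict hM hstat HK oU).
- exact: proj_equivalent.
Qed.
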